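(* Let $R$ be a commutative computable ring and let $\mathfrak{m}=\langle m_1,\ldots,m_k\rangle$ be a finitely generated maximal ideal in $R$. Then the category $R_{\mathfrak{m}}\text{-}\mathbf{fpres}$ of finite $R_{\mathfrak m}$-presentations is Abelian and is computable as an Abelian category with enough projectives.
   Context: Rings are associative with $1$. All matrices are finite (with sizes allowed to be $0$). Composition convention: for $\phi:M\to L$ and $\psi:L\to N$ the composite $M\to N$ is written $\phi\psi$. **Computable ring.** For $A\in R^{r_1\times r_0}$, $X=\mathtt{SyzygiesGenerators}(A)$ denotes a matrix $X\in R^{r_2\times r_1}$ whose rows generate the kernel of $R^{1\times r_1}\to R^{1\times r_0}$, $x\mapsto xA$. For $A\in R^{r_1\times r_0}$, $B\in R^{r_2\times r_0}$, $(N,T)=\mathtt{DecideZeroEffectively}(A,B)$ denotes matrices with $N=TA+B$ such that whenever the $i$-th row of $B$ is an $R$-linear combination of the rows of $A$, the $i$-th row of $N$ is zero. A ring $R$ is left computable if there exist algorithms computing $\mathtt{SyzygiesGenerators}(A)$ and $\mathtt{DecideZeroEffectively}(A,B)$ (so one can effectively solve linear systems $XA=B$); right computable is defined analogously for systems $AX=B$; computable means left and right computable. **Localization.** $R_{\mathfrak m}=S^{-1}R$ with $S=R\setminus\mathfrak m$. **The category $Q\text{-}\mathbf{fpres}$** for a ring $Q$ (here $Q=R_{\mathfrak m}$). Objects are finite matrices over $Q$, where two matrices $\mathtt M\in Q^{r_1\times r_0}$ and $\mathtt M'\in Q^{r_1'\times r_0}$ with the same number of columns are identified to one object if $Q^{1\times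 r_1}\mathtt M=Q^{1\times r_1'}\mathtt M'$ as submodules of $Q^{1\times r_0}$. For a matrix $\mathtt M\in Q^{r_1\times r_0}$ put $\operatorname{coker}\mathtt M:=Q^{1\times r_0}/Q^{1\times r_1}\mathtt M$. Morphisms from $\mathtt M\in Q^{r_1\times r_0}$ to $\mathtt L\in Q^{r_1'\times r_0'}$ are the $r_0\times r_0'$-matrices $\varphi$ over $Q$ with $Q^{1\times r_1}\mathtt M\varphi\le Q^{1\times r_1'}\mathtt L$, where two matrices are identified to one morphism if they induce the same $Q$-module homomorphism $\operatorname{coker}\mathtt M\to\operatorname{coker}\mathtt L$. Composition is matrix multiplication. Free modules used in constructions are given on a free set of generators: a free module of rank $r$ is presented by the empty matrix in $Q^{0\times r}$. **Computable as an Abelian category.** An Abelian category $\mathcal A$ is computable as an Abelian category if all the existential quantifiers in the following list can be turned into constructive ones (i.e. realized by algorithms), the objects and morphisms being required to satisfy the usual universal properties: (1) for any object $M$ there exists an identity morphism $1_M$; (2) for any two composable morphisms $\phi,\psi$ there exists a composition $\phi\psi$; (3) there exists a zero object $0$; (4) for all objects $M,N$ there exists a zero morphism $0_{MN}$; (5) for all $M,N$ there exists an addition $(\phi,\psi)\mapsto\phi+\psi$ in the Abelian group $\operatorname{Hom}_{\mathcal A}(M,N)$; (6) for all $M,N$ there exists a subtraction $(\phi,\psi)\mapsto\phi-\psi$ in $\operatorname{Hom}_{\mathcal A}(M,N)$; (7) for all objects $A_1,A_2$ there exists a direct sum $A_1\oplus A_2$; (8) for all pairs $\phi_i:A_i\to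 M$, $i=1,2$, there exists a coproduct morphism $\langle\phi_1,\phi_2\rangle:A_1\oplus A_2\to M$; (9) for all pairs $\phi_i:M\to A_i$, $i=1,2$, there exists a product morphism $\{\phi_1,\phi_2\}:M\to A_1\oplus A_2$; (10) for any morphism $\phi:M\to N$ there exists a kernel $\kappa:\ker\phi\hookrightarrow M$, such that (11) for any morphism $\tau:L\to M$ with $\tau\phi=0$ there exists a unique lift $\tau_0:L\to\ker\phi$ with $\tau_0\kappa=\tau$; (12) for any morphism $\phi:M\to N$ there exists a cokernel $\epsilon:N\twoheadrightarrow\operatorname{coker}\phi$, such that (13) for any morphism $\eta:N\to L$ with $\phi\eta=0$ there exists a unique colift $\eta_0:\operatorname{coker}\phi\to L$ with $\epsilon\eta_0=\eta$. It is computable as an Abelian category with enough projectives if additionally the existential quantifiers in the following can be turned into constructive ones: (14) $P$ is called projective if for each morphism $\phi:P\to N$ and each morphism $\epsilon:M\to N$ with $\operatorname{im}\phi\le\operatorname{im}\epsilon$ there exists a projective lift $\phi_1:P\to M$ of $\phi$ along $\epsilon$, i.e. $\phi_1\epsilon=\phi$; (15) for each object $M$ there exists a projective hull, i.e. an epimorphism $\nu:P\twoheadrightarrow M$ with $P$ projective. *)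

(* Defs.v *)
From HB Require Import structures.
From mathcomp Require Import all_boot all_order all_algebra.
From mathcomp Require Import ring boolp classical_sets.

Set Implicit Arguments.
Unset Strict Implicit.
Unset Printing Implicit Defensive.

Import GRing.Theory.
Local Open Scope ring_scope.
Local Open Scope quotient_scope.

(* An "algorithm" is a program of a fixed Turing-complete language, not a Rocq
   function: in the presence of classical choice the latter would make every
   existence statement effective.  The language is (a combinator form of) Jones'
   WHILE language, whose only data are binary trees (S-expressions). *)

Inductive tree := Leaf | Node of tree & tree.

Definition hd_tree t := if t is Node a _ then a else Leaf.
Definition tl_tree t := if t is Node _ b then b else Leaf.

Inductive prog :=
| PId
| PLeaf
| PHd
| PTl
| PNode of prog & prog
| PSeq of prog & prog
| PIf of prog & prog & prog
| PWhile of prog & prog.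

(* [run p x y]: on input [x], the program [p] terminates with output [y].
   In [PIf c p q] and [PWhile c p], the test [c] reads [Leaf] as false and every
   other tree as true. *)
Inductive run : prog -> tree -> tree -> Prop :=
| run_id x : run PId x x
| run_leaf x : run PLeaf x Leaf
| run_hd x : run PHd x (hd_tree x)
| run_tl x : run PTl x (tl_tree x)
| run_node p q x y z : run p x y -> run q x z -> run (PNode p q) x (Node y z)
| run_seq p q x y z : run p x y -> run q y z -> run (PSeq p q) x z
| run_if_true c p q x a b y :
    run c x (Node a b) -> run p x y -> run (PIf c p q) x y
| run_if_false c p q x y :
    run c x Leaf -> run q x y -> run (PIf c p q) x y
| run_while_true c p x a b y z :
    run c x (Node a b) -> run p x y -> run (PWhile c p) y z ->
    run (PWhile c p) x z
| run_while_false c p x :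
    run c x Leaf -> run (PWhile c p) x x.

Definition computes (p : prog) (x : tree) (P : tree -> Prop) : Prop :=
  exists2 y, run p x y & P y.

Fixpoint list_tree (s : seq tree) : tree :=
  if s is t :: s' then Node t (list_tree s') else Leaf.

Definition nat_tree (n : nat) : tree := list_tree (nseq n Leaf).
Definition bool_tree (b : bool) : tree := if b then Node Leaf Leaf else Leaf.

(* [rep t x] reads "t is a code of x".  An element may have several codes. *)
Definition is_coding (T : Type) (rep : tree -> T -> Prop) : Prop :=
  (forall t x y, rep t x -> rep t y -> x = y) /\ (forall x, exists t, rep t x).

(* The code of a matrix consists of its two dimensions (needed since they may
   be 0) and the list of its rows. *)
Definition mx_code (T : Type) (rep : tree -> T -> Prop) (r c : nat)
    (t : tree) (A : 'M[T]_(r, c)) : Prop :=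
  exists2 E : 'I_r -> 'I_c -> tree,
    forall i j, rep (E i j) (A i j) &
    t = list_tree [:: nat_tree r; nat_tree c;
          list_tree [seq list_tree [seq E i j | j <- enum 'I_c]
                    | i <- enum 'I_r]].

Section ComputableRing.
Variables (R : pzRingType) (rep : tree -> R -> Prop).

(* The elements of R can be stored and handled: effective arithmetic and
   equality test.  (0 and 1 need no program: a program may contain constants.) *)
Definition effective_ring : Prop :=
  [/\ is_coding rep,
      exists p, forall t u x y, rep t x -> rep u y ->
        computes p (list_tree [:: t; u]) (fun d => rep d (x + y)),
      exists p, forall t x, rep t x -> computes p t (fun d => rep d (- x)),
      exists p, forall t u x y, rep t x -> rep u y ->
        computes p (list_tree [:: t; u]) (fun d => rep d (x * y)) &
      exists p, forall t u x y, rep t x -> rep u y ->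
        run p (list_tree [:: t; u]) (bool_tree (x == y))].

Definition is_left_syzygies r2 r1 r0 (A : 'M[R]_(r1, r0)) (X : 'M[R]_(r2, r1)) :=
  forall x : 'rV[R]_r1, x *m A = 0 <-> exists y : 'rV[R]_r2, x = y *m X.

Definition is_left_decide_zero r2 r1 r0 (A : 'M[R]_(r1, r0)) (B : 'M[R]_(r2, r0))
    (N : 'M[R]_(r2, r0)) (T : 'M[R]_(r2, r1)) :=
  N = T *m A + B /\
  forall i, (exists y : 'rV[R]_r1, row i B = y *m A) -> row i N = 0.

Definition is_right_syzygies r0 r1 r2 (A : 'M[R]_(r0, r1)) (X : 'M[R]_(r1, r2)) :=
  forall x : 'cV[R]_r1, A *m x = 0 <-> exists y : 'cV[R]_r2, x = X *m y.

Definition is_right_decide_zero r0 r1 r2 (A : 'M[R]_(r0, r1)) (B : 'M[R]_(r0, r2))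
    (N : 'M[R]_(r0, r2)) (T : 'M[R]_(r1, r2)) :=
  N = A *m T + B /\
  forall j, (exists y : 'cV[R]_r1, col j B = A *m y) -> col j N = 0.

Definition left_computable : Prop :=
  (exists syz, forall r1 r0 (A : 'M[R]_(r1, r0)) t, mx_code rep t A ->
     computes syz t (fun d =>
       exists r2 (X : 'M[R]_(r2, r1)), mx_code rep d X /\ is_left_syzygies A X)) /\
  (exists dze, forall r2 r1 r0 (A : 'M[R]_(r1, r0)) (B : 'M[R]_(r2, r0)) t u,
     mx_code rep t A -> mx_code rep u B ->
     computes dze (list_tree [:: t; u]) (fun d =>
       exists N T dN dT,
         [/\ d = list_tree [:: dN; dT], mx_code rep dN N, mx_code rep dT T &
             is_left_decide_zero A B N T])).

Definition right_computable : Prop :=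
  (exists syz, forall r0 r1 (A : 'M[R]_(r0, r1)) t, mx_code rep t A ->
     computes syz t (fun d =>
       exists r2 (X : 'M[R]_(r1, r2)), mx_code rep d X /\ is_right_syzygies A X)) /\
  (exists dze, forall r0 r1 r2 (A : 'M[R]_(r0, r1)) (B : 'M[R]_(r0, r2)) t u,
     mx_code rep t A -> mx_code rep u B ->
     computes dze (list_tree [:: t; u]) (fun d =>
       exists N T dN dT,
         [/\ d = list_tree [:: dN; dT], mx_code rep dN N, mx_code rep dT T &
             is_right_decide_zero A B N T])).

Definition computable_ring : Prop :=
  [/\ effective_ring, left_computable & right_computable].

End ComputableRing.

Section Ideals.
Variable R : comNzRingType.

(* [idealr_closed] includes properness, [1 \notin m]. *)
Definition maximal_ideal (m : {pred R}) : Prop :=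
  idealr_closed m /\
  forall J : {pred R}, idealr_closed J -> {subset m <= J} -> {subset J <= m}.

Definition ideal_gen k (ms : 'I_k -> R) : {pred R} :=
  [pred x | `[< exists a : 'I_k -> R, x = \sum_i a i * ms i >]].

Lemma maximal_compl_closed (m : {pred R}) :
  maximal_ideal m -> mulr_closed [predC m].
Proof.
move=> [[m0 m1 mC] maxm]; have mD u v : u \in m -> v \in m -> u + v \in m.
  by move=> um vm; rewrite -[u]mul1r mC.
have mM a u : u \in m -> a * u \in m by move=> um; rewrite -[_ * _]addr0 mC.
split=> [//|u v]; rewrite !inE => um vm; apply/negP => uvm.
pose J : {pred R} := [pred x | `[< exists a, x - a * u \in m >]].
have mJ : {subset m <= J}.
  by move=> x xm; apply/asboolP; exists 0; rewrite mul0r subr0.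
have uJ : u \in J by apply/asboolP; exists 1; rewrite mul1r subrr.
have [/asboolP[a am]|n1J] := boolP (1 \in J).
  have ev : v = v * (1 - a * u) + a * (u * v) by ring.
  by move/negP: vm; apply; rewrite ev; apply: mD; apply: mM.
suff idJ : idealr_closed J by move: um; rewrite (maxm J idJ mJ).
split=> // [|a x y /asboolP[b xb] /asboolP[c yc]]; first exact: mJ.
apply/asboolP; exists (a * b + c).
have -> : a * x + y - (a * b + c) * u = a * (x - b * u) + (y - c * u) by ring.
by apply: mD; first exact: mM.
Qed.

End Ideals.

Module Localization.
Section Localization.
Variables (R : comPzRingType) (S : {pred R}) (hS : mulr_closed S).

Record ratio := Ratio {numden : R * R; _ : numden.2 \in S}.
HB.instance Definition _ := [isSub for numden].
HB.instance Definition _ := [Choice of ratio by <:].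

Notation num x := (numden x).1.
Notation den x := (numden x).2.

Lemma denP x : den x \in S. Proof. by case: x. Qed.

Lemma S1 : 1 \in S. Proof. by case: hS. Qed.
Lemma SM u v : u \in S -> v \in S -> u * v \in S.
Proof. by case: hS => _; apply. Qed.

Definition eqr (x y : ratio) : bool :=
  `[< exists2 s, s \in S & s * (num x * den y) = s * (num y * den x) >].

Lemma eqr_refl : reflexive eqr.
Proof. by move=> x; apply/asboolP; exists 1; rewrite ?S1. Qed.

Lemma eqr_sym : symmetric eqr.
Proof. by move=> x y; apply/asboolP/asboolP => -[s sS e]; exists s. Qed.

Lemma eqr_trans : transitive eqr.
Proof.
move=> y x z /asboolP[s sS e] /asboolP[t tS f]; apply/asboolP.
exists (s * t * den y); first by rewrite !SM ?denP.
transitivity (t * den z * (s * (num x * den y))); first by ring.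
rewrite e; transitivity (s * den x * (t * (num y * den z))); first by ring.
by rewrite f; ring.
Qed.

Canonical eqr_equiv := EquivRel eqr eqr_refl eqr_sym eqr_trans.

Definition type := {eq_quot eqr}.
HB.instance Definition _ : EqQuotient _ eqr type := EqQuotient.on type.
HB.instance Definition _ := Choice.on type.

Lemma ratio_eq (x y : ratio) s : s \in S ->
  s * (num x * den y) = s * (num y * den x) -> x = y %[mod type].
Proof. by move=> sS e; apply/eqmodP/asboolP; exists s. Qed.

Lemma ratio_eq1 (x y : ratio) :
  num x * den y = num y * den x -> x = y %[mod type].
Proof. by move=> e; apply: (ratio_eq S1); rewrite e. Qed.

Lemma ratio_repr (x : ratio) : exists2 s, s \in S &
  s * (num (repr (\pi_type x)) * den x) = s * (num x * den (repr (\pi_type x))).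
Proof.
have /eqmodP/asboolP : repr (\pi_type x) = x %[mod type] by rewrite reprK.
by [].
Qed.

Definition ratio0 := Ratio (numden := (0, 1)) S1.
Definition ratio1 := Ratio (numden := (1, 1)) S1.
Definition addr (x y : ratio) := Ratio
  (numden := (num x * den y + num y * den x, den x * den y))
  (SM (denP x) (denP y)).
Definition oppr (x : ratio) := Ratio (numden := (- num x, den x)) (denP x).
Definition mulr (x y : ratio) := Ratio
  (numden := (num x * num y, den x * den y)) (SM (denP x) (denP y)).

Definition zero : type := \pi_type ratio0.
Definition one : type := \pi_type ratio1.
Definition add (a b : type) : type := \pi_type (addr (repr a) (repr b)).
Definition opp (a : type) : type := \pi_type (oppr (repr a)).
Definition mul (a b : type) : type := \pi_type (mulr (repr a) (repr b)).

Lemma pi_add x y : add (\pi_type x) (\pi_type y) = \pi_type (addr x y).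
Proof.
have [s sS e] := ratio_repr x; have [t tS f] := ratio_repr y.
apply: (ratio_eq (SM sS tS)) => /=.
set x' := repr _ in e *; set y' := repr _ in f *.
transitivity (s * (num x' * den x) * (t * den y * den y') +
              t * (num y' * den y) * (s * den x * den x')); first by ring.
by rewrite e f; ring.
Qed.

Lemma pi_opp x : opp (\pi_type x) = \pi_type (oppr x).
Proof.
have [s sS e] := ratio_repr x; apply: (ratio_eq sS) => /=.
by rewrite !mulNr !mulrN e.
Qed.

Lemma pi_mul x y : mul (\pi_type x) (\pi_type y) = \pi_type (mulr x y).
Proof.
have [s sS e] := ratio_repr x; have [t tS f] := ratio_repr y.
apply: (ratio_eq (SM sS tS)) => /=.
set x' := repr _ in e *; set y' := repr _ in f *.
transitivity (s * (num x' * den x) * (t * (num y' * den y))); first by ring.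
by rewrite e f; ring.
Qed.

Lemma addA : associative add.
Proof.
elim/quotW=> x; elim/quotW=> y; elim/quotW=> z.
rewrite (pi_add y z) (pi_add x y) !pi_add.
by apply: ratio_eq1 => /=; ring.
Qed.

Lemma addC : commutative add.
Proof.
elim/quotW=> x; elim/quotW=> y; rewrite (pi_add x y) (pi_add y x).
by apply: ratio_eq1 => /=; ring.
Qed.

Lemma add0 : left_id zero add.
Proof. by elim/quotW=> x; rewrite (pi_add ratio0 x); apply: ratio_eq1 => /=; ring. Qed.

Lemma addN : left_inverse zero opp add.
Proof.
by elim/quotW=> x; rewrite (pi_opp x) pi_add; apply: ratio_eq1 => /=; ring.
Qed.

HB.instance Definition _ := GRing.isZmodule.Build type addA addC add0 addN.

Lemma mulA : associative mul.
Proof.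
elim/quotW=> x; elim/quotW=> y; elim/quotW=> z.
rewrite (pi_mul y z) (pi_mul x y) !pi_mul.
by apply: ratio_eq1 => /=; ring.
Qed.

Lemma mulC : commutative mul.
Proof.
elim/quotW=> x; elim/quotW=> y; rewrite (pi_mul x y) (pi_mul y x).
by apply: ratio_eq1 => /=; ring.
Qed.

Lemma mul1 : left_id one mul.
Proof. by elim/quotW=> x; rewrite (pi_mul ratio1 x); apply: ratio_eq1 => /=; ring. Qed.

Lemma mulD : left_distributive mul add.
Proof.
elim/quotW=> x; elim/quotW=> y; elim/quotW=> z.
rewrite (pi_add x y) (pi_mul x z) (pi_mul y z) pi_mul pi_add.
by apply: ratio_eq1 => /=; ring.
Qed.

HB.instance Definition _ :=
  GRing.Zmodule_isComPzRing.Build type mulA mulC mul1 mulD.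

(* A code of a fraction is the pair of a code of its numerator and a code of its
   denominator; no normal form is required. *)
Definition code (rep : tree -> R -> Prop) (t : tree) (q : type) : Prop :=
  exists (x : ratio) u v,
    [/\ rep u (num x), rep v (den x), t = list_tree [:: u; v] & q = \pi_type x].

End Localization.
End Localization.
HB.export Localization.

Notation localization := Localization.type.

Definition local_ring (R : comNzRingType) (m : {pred R}) (hm : maximal_ideal m) :
    comPzRingType :=
  localization (maximal_compl_closed hm).

Definition local_code (R : comNzRingType) (rep : tree -> R -> Prop)
    (m : {pred R}) (hm : maximal_ideal m) : tree -> local_ring hm -> Prop :=
  Localization.code rep.

Arguments local_code {R} rep {m} hm t q.

(* [comp f g], written [f ;; g], is "f followed by g". *)
Record preadditive := Preadditive {
  obj :> Type;
  hom : obj -> obj -> zmodType;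
  idm : forall M, hom M M;
  comp : forall M N L, hom M N -> hom N L -> hom M L;
  compA : forall M N L K (f : hom M N) (g : hom N L) (h : hom L K),
    comp f (comp g h) = comp (comp f g) h;
  comp1m : forall M N (f : hom M N), comp (idm M) f = f;
  compm1 : forall M N (f : hom M N), comp f (idm N) = f;
  compDl : forall M N L (f g : hom M N) (h : hom N L),
    comp (f + g) h = comp f h + comp g h;
  compDr : forall M N L (f : hom M N) (g h : hom N L),
    comp f (g + h) = comp f g + comp f h }.

Arguments idm {p} M.

Notation "f ;; g" := (comp f g) (at level 40, left associativity).

Section Abelian.
Variable C : preadditive.
Implicit Types M N L K A S P : C.

Definition mono M N (f : hom M N) :=
  forall L (g h : hom L M), g ;; f = h ;; f -> g = h.

Definition epi M N (f : hom M N) :=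
  forall L (g h : hom N L), f ;; g = f ;; h -> g = h.

Definition is_zero_obj Z :=
  (forall M, exists! f : hom M Z, True) /\ (forall M, exists! f : hom Z M, True).

Definition is_kernel M N (phi : hom M N) K (kappa : hom K M) :=
  kappa ;; phi = 0 /\
  forall L (tau : hom L M), tau ;; phi = 0 -> exists! tau0, tau0 ;; kappa = tau.

Definition is_cokernel M N (phi : hom M N) K (eps : hom N K) :=
  phi ;; eps = 0 /\
  forall L (eta : hom N L), phi ;; eta = 0 -> exists! eta0, eps ;; eta0 = eta.

Definition is_direct_sum A1 A2 S
    (i1 : hom A1 S) (i2 : hom A2 S) (p1 : hom S A1) (p2 : hom S A2) :=
  [/\ [/\ i1 ;; p1 = idm A1, i2 ;; p2 = idm A2, i1 ;; p2 = 0 & i2 ;; p1 = 0],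
      forall M (phi1 : hom A1 M) (phi2 : hom A2 M),
        exists! phi, i1 ;; phi = phi1 /\ i2 ;; phi = phi2 &
      forall M (phi1 : hom M A1) (phi2 : hom M A2),
        exists! phi, phi ;; p1 = phi1 /\ phi ;; p2 = phi2].

Definition abelian : Prop :=
  [/\ exists Z, is_zero_obj Z,
      forall A1 A2, exists S i1 i2 p1 p2, @is_direct_sum A1 A2 S i1 i2 p1 p2,
      forall M N (phi : hom M N),
        (exists K (kappa : hom K M), is_kernel phi kappa) /\
        (exists K (eps : hom N K), is_cokernel phi eps),
      forall M N (f : hom M N), mono f -> exists L (g : hom N L), is_kernel g f &
      forall M N (f : hom M N), epi f -> exists L (g : hom L M), is_cokernel g f].

Definition is_image M N (phi : hom M N) I (iota : hom I N) :=
  exists K (eps : hom N K), is_cokernel phi eps /\ is_kernel eps iota.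

(* im phi <= im eps, as subobjects of N *)
Definition im_le P M N (phi : hom P N) (eps : hom M N) :=
  exists I (i : hom I N) J (j : hom J N),
    [/\ is_image phi i, is_image eps j & exists f, f ;; j = i].

Definition projective P :=
  forall M N (phi : hom P N) (eps : hom M N), im_le phi eps ->
    exists phi1, phi1 ;; eps = phi.

Record coding := Coding {
  obj_code : tree -> C -> Prop;
  hom_code : forall M N, tree -> hom M N -> Prop }.

Variable rho : coding.

Definition valid_coding : Prop :=
  is_coding (obj_code rho) /\ forall M N, is_coding (@hom_code rho M N).

(* Below, [t_X] ranges over the codes of the object or morphism X.  A lift
   (colift, product or coproduct morphism) is relative to the kernel (cokernel,
   direct sum) that the first program computes from the same codes. *)

Definition effective_id : Prop :=
  exists p, forall M t_M, obj_code rho t_M M ->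
    computes p t_M (fun d => hom_code rho d (idm M)).

Definition effective_comp : Prop :=
  exists p, forall M N L (phi : hom M N) (psi : hom N L) t_M t_N t_L t_phi t_psi,
    obj_code rho t_M M -> obj_code rho t_N N -> obj_code rho t_L L ->
    hom_code rho t_phi phi -> hom_code rho t_psi psi ->
    computes p (list_tree [:: t_M; t_N; t_L; t_phi; t_psi])
      (fun d => hom_code rho d (phi ;; psi)).

Definition effective_zero_obj : Prop :=
  exists p, computes p Leaf (fun d => exists2 Z, obj_code rho d Z & is_zero_obj Z).

Definition effective_zero_hom : Prop :=
  exists p, forall M N t_M t_N, obj_code rho t_M M -> obj_code rho t_N N ->
    computes p (list_tree [:: t_M; t_N])
      (fun d => hom_code rho d (0 : hom M N)).

Definition effective_add : Prop :=
  exists p, forall M N (phi psi : hom M N) t_M t_N t_phi t_psi,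
    obj_code rho t_M M -> obj_code rho t_N N ->
    hom_code rho t_phi phi -> hom_code rho t_psi psi ->
    computes p (list_tree [:: t_M; t_N; t_phi; t_psi])
      (fun d => hom_code rho d (phi + psi)).

Definition effective_sub : Prop :=
  exists p, forall M N (phi psi : hom M N) t_M t_N t_phi t_psi,
    obj_code rho t_M M -> obj_code rho t_N N ->
    hom_code rho t_phi phi -> hom_code rho t_psi psi ->
    computes p (list_tree [:: t_M; t_N; t_phi; t_psi])
      (fun d => hom_code rho d (phi - psi)).

Definition effective_direct_sum : Prop :=
  exists p_sum p_coprod p_prod, forall A1 A2 t_A1 t_A2,
    obj_code rho t_A1 A1 -> obj_code rho t_A2 A2 ->
    computes p_sum (list_tree [:: t_A1; t_A2]) (fun d =>
      exists S (i1 : hom A1 S) (i2 : hom A2 S) (p1 : hom S A1) (p2 : hom S A2)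
             t_S t_i1 t_i2 t_p1 t_p2,
        [/\ d = list_tree [:: t_S; t_i1; t_i2; t_p1; t_p2],
            [/\ obj_code rho t_S S, hom_code rho t_i1 i1, hom_code rho t_i2 i2,
                hom_code rho t_p1 p1 & hom_code rho t_p2 p2],
            is_direct_sum i1 i2 p1 p2,
            forall M (phi1 : hom A1 M) (phi2 : hom A2 M) t_M t_phi1 t_phi2,
              obj_code rho t_M M ->
              hom_code rho t_phi1 phi1 -> hom_code rho t_phi2 phi2 ->
              computes p_coprod (list_tree [:: t_A1; t_A2; t_M; t_phi1; t_phi2])
                (fun d' => exists phi, [/\ hom_code rho d' phi,
                   i1 ;; phi = phi1 & i2 ;; phi = phi2]) &
            forall M (phi1 : hom M A1) (phi2 : hom M A2) t_M t_phi1 t_phi2,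
              obj_code rho t_M M ->
              hom_code rho t_phi1 phi1 -> hom_code rho t_phi2 phi2 ->
              computes p_prod (list_tree [:: t_A1; t_A2; t_M; t_phi1; t_phi2])
                (fun d' => exists phi, [/\ hom_code rho d' phi,
                   phi ;; p1 = phi1 & phi ;; p2 = phi2])]).

Definition effective_kernel : Prop :=
  exists p_ker p_lift, forall M N (phi : hom M N) t_M t_N t_phi,
    obj_code rho t_M M -> obj_code rho t_N N -> hom_code rho t_phi phi ->
    computes p_ker (list_tree [:: t_M; t_N; t_phi]) (fun d =>
      exists K (kappa : hom K M) t_K t_kappa,
        [/\ d = list_tree [:: t_K; t_kappa],
            obj_code rho t_K K /\ hom_code rho t_kappa kappa,
            is_kernel phi kappa &
            forall L (tau : hom L M) t_L t_tau,
              obj_code rho t_L L -> hom_code rho t_tau tau -> tau ;; phi = 0 ->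
              computes p_lift (list_tree [:: t_M; t_N; t_phi; t_L; t_tau])
                (fun d' => exists tau0,
                   hom_code rho d' tau0 /\ tau0 ;; kappa = tau)]).

Definition effective_cokernel : Prop :=
  exists p_coker p_colift, forall M N (phi : hom M N) t_M t_N t_phi,
    obj_code rho t_M M -> obj_code rho t_N N -> hom_code rho t_phi phi ->
    computes p_coker (list_tree [:: t_M; t_N; t_phi]) (fun d =>
      exists K (eps : hom N K) t_K t_eps,
        [/\ d = list_tree [:: t_K; t_eps],
            obj_code rho t_K K /\ hom_code rho t_eps eps,
            is_cokernel phi eps &
            forall L (eta : hom N L) t_L t_eta,
              obj_code rho t_L L -> hom_code rho t_eta eta -> phi ;; eta = 0 ->
              computes p_colift (list_tree [:: t_M; t_N; t_phi; t_L; t_eta])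
                (fun d' => exists eta0,
                   hom_code rho d' eta0 /\ eps ;; eta0 = eta)]).

Definition effective_projective_lift : Prop :=
  exists p, forall P M N (phi : hom P N) (eps : hom M N) t_P t_M t_N t_phi t_eps,
    obj_code rho t_P P -> obj_code rho t_M M -> obj_code rho t_N N ->
    hom_code rho t_phi phi -> hom_code rho t_eps eps ->
    projective P -> im_le phi eps ->
    computes p (list_tree [:: t_P; t_M; t_N; t_phi; t_eps])
      (fun d => exists phi1, hom_code rho d phi1 /\ phi1 ;; eps = phi).

Definition effective_projective_hull : Prop :=
  exists p, forall M t_M, obj_code rho t_M M ->
    computes p t_M (fun d => exists P (nu : hom P M) t_P t_nu,
      [/\ d = list_tree [:: t_P; t_nu],
          obj_code rho t_P P /\ hom_code rho t_nu nu, epi nu & projective P]).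

Definition computable_abelian : Prop :=
  [/\ abelian, valid_coding,
      [/\ effective_id, effective_comp, effective_zero_obj & effective_zero_hom],
      effective_add /\ effective_sub &
      [/\ effective_direct_sum, effective_kernel & effective_cokernel]].

Definition computable_abelian_enough_projectives : Prop :=
  [/\ computable_abelian, effective_projective_lift & effective_projective_hull].

End Abelian.

Section FPres.
Variable Q : pzRingType.

Definition rowspan r c (A : 'M[Q]_(r, c)) : set 'rV[Q]_c :=
  [set v | exists y : 'rV[Q]_r, v = y *m A].

(* Matrices with the same number of columns and the same row space are one
   object; hence an object is the number of columns together with the common row
   space ([rels]), and the object of a matrix A is [fpobj_of A]. *)
Record fpobj := FPObj {
  gens : nat;
  rels : set 'rV[Q]_gens;
  rels_fg : exists r (A : 'M[Q]_(r, gens)), rels = rowspan A }.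

Arguments rels M : rename, clear implicits.

Definition fpobj_of r c (A : 'M[Q]_(r, c)) : fpobj :=
  FPObj (ex_intro _ r (ex_intro _ A erefl)).

Lemma fpobj_of_surj (M : fpobj) : exists r c (A : 'M[Q]_(r, c)), M = fpobj_of A.
Proof.
case: M => c U [r [A eU]]; exists r, c, A; rewrite /fpobj_of.
by subst U; congr FPObj; apply: Prop_irrelevance.
Qed.

Lemma fpobj_of_eq r r' c (A : 'M[Q]_(r, c)) (B : 'M[Q]_(r', c)) :
  fpobj_of A = fpobj_of B <-> rowspan A = rowspan B.
Proof.
split=> [e|e]; last first.
  rewrite /fpobj_of; move: (ex_intro _ r _) (ex_intro _ r' _) => /=.
  by rewrite e => h h'; congr FPObj; apply: Prop_irrelevance.
have h (M N : fpobj) (eMN : M = N) (eg : gens M = gens N) :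
    rels M = fun v => rels N (castmx (erefl, eg) v).
  by subst N; rewrite (eq_irrelevance eg erefl); apply/funext.
by rewrite [LHS](h _ _ e erefl); apply/funext => v; rewrite castmx_id.
Qed.

Lemma rels0 M : rels M 0.
Proof. by case: M => c U /= [r [A ->]]; exists 0; rewrite mul0mx. Qed.

Lemma relsB M u v : rels M u -> rels M v -> rels M (u - v).
Proof.
case: M u v => c U /= [r [A ->]] u v [y ->] [z ->].
by exists (y - z); rewrite mulmxBl.
Qed.

Section Hom.
Variables M L : fpobj.

Definition is_fpmor : {pred 'M[Q]_(gens M, gens L)} :=
  [pred phi | `[< forall u, rels M u -> rels L (u *m phi) >]].

Lemma is_fpmor_closed : zmod_closed is_fpmor.
Proof.
split; first by apply/asboolP => u _; rewrite mulmx0; apply: rels0.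
move=> f g /asboolP hf /asboolP hg; apply/asboolP => u hu.
by rewrite mulmxBr; apply: relsB; [apply: hf | apply: hg].
Qed.
HB.instance Definition _ :=
  GRing.isZmodClosed.Build _ is_fpmor is_fpmor_closed.

Record fpmor := FPMor {
  fpmor_mx : 'M[Q]_(gens M, gens L); _ : fpmor_mx \in is_fpmor }.
HB.instance Definition _ := [isSub for fpmor_mx].
HB.instance Definition _ := [Choice of fpmor by <:].
HB.instance Definition _ := [SubChoice_isSubZmodule of fpmor by <:].

(* phi and psi induce the same map coker M -> coker L iff x phi and x psi are
   congruent modulo [rels L] for every row x, i.e. iff phi - psi is null. *)
Definition fpmor_null : {pred fpmor} :=
  [pred phi | `[< forall x, rels L (x *m fpmor_mx phi) >]].

Lemma fpmor_null_closed : zmod_closed fpmor_null.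
Proof.
split; first by apply/asboolP => x; rewrite mulmx0; apply: rels0.
move=> f g /asboolP hf /asboolP hg; apply/asboolP => x.
by rewrite mulmxBr; apply: relsB; [apply: hf | apply: hg].
Qed.
HB.instance Definition _ :=
  GRing.isZmodClosed.Build _ fpmor_null fpmor_null_closed.

Definition fphom : zmodType := {ideal_quot fpmor_null}.

Definition fphom_of (phi : fpmor) : fphom := \pi_{ideal_quot fpmor_null} phi.

Lemma fpmorP (phi : fpmor) u : rels M u -> rels L (u *m fpmor_mx phi).
Proof. by case: phi => /= f /asboolP; apply. Qed.

Lemma fphom_ofE (phi psi : fpmor) : fphom_of phi = fphom_of psi <->
  forall x, rels L (x *m fpmor_mx phi - x *m fpmor_mx psi).
Proof.
split=> [e x|h].
  have : phi - psi \in fpmor_null by rewrite Quotient.idealrBE; apply/eqP.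
  by move/asboolP/(_ x); rewrite /= mulmxBr.
apply/eqP; rewrite -Quotient.idealrBE; apply/asboolP => x.
by rewrite /= mulmxBr.
Qed.

Lemma fphom_ofD (phi psi : fpmor) :
  fphom_of (phi + psi) = fphom_of phi + fphom_of psi.
Proof. by rewrite /fphom_of !piE. Qed.

Lemma fphom_of_repr (f : fphom) : fphom_of (repr f) = f.
Proof. exact: reprK. Qed.

Lemma fphom_of_surj (f : fphom) : exists phi, f = fphom_of phi.
Proof. by exists (repr f); rewrite fphom_of_repr. Qed.

End Hom.

Arguments is_fpmor : clear implicits.
Arguments fpmor_null : clear implicits.

Lemma fpmor_id_subproof M : 1%:M \in is_fpmor M M.
Proof. by apply/asboolP => u; rewrite mulmx1. Qed.
Definition fpmor_id M : fpmor M M := FPMor (fpmor_id_subproof M).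

Lemma fpmor_comp_subproof M N L (phi : fpmor M N) (psi : fpmor N L) :
  fpmor_mx phi *m fpmor_mx psi \in is_fpmor M L.
Proof. by apply/asboolP => u hu; rewrite mulmxA; do 2!apply: fpmorP. Qed.
Definition fpmor_comp M N L (phi : fpmor M N) (psi : fpmor N L) : fpmor M L :=
  FPMor (fpmor_comp_subproof phi psi).

Definition fphom_comp M N L (f : fphom M N) (g : fphom N L) : fphom M L :=
  fphom_of (fpmor_comp (repr f) (repr g)).

Lemma fphom_comp_of M N L (phi : fpmor M N) (psi : fpmor N L) :
  fphom_comp (fphom_of phi) (fphom_of psi) = fphom_of (fpmor_comp phi psi).
Proof.
apply/fphom_ofE => x /=; rewrite !mulmxA.
have /fphom_ofE/(_ x) h1 := fphom_of_repr (fphom_of phi).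
have /fphom_ofE/(_ (x *m fpmor_mx phi)) h2 := fphom_of_repr (fphom_of psi).
have h3 := fpmorP (repr (fphom_of psi)) h1.
have := relsB h3 (relsB (rels0 L) h2).
by rewrite sub0r opprK mulmxBl addrA subrK.
Qed.

Lemma fphom_compA M N L K (f : fphom M N) (g : fphom N L) (h : fphom L K) :
  fphom_comp f (fphom_comp g h) = fphom_comp (fphom_comp f g) h.
Proof.
case: (fphom_of_surj f) (fphom_of_surj g) (fphom_of_surj h)
  => phi -> [psi ->] [chi ->].
rewrite (fphom_comp_of psi chi) (fphom_comp_of phi psi) !fphom_comp_of.
by congr fphom_of; apply: val_inj; rewrite /= mulmxA.
Qed.

Lemma fphom_comp1m M N (f : fphom M N) :
  fphom_comp (fphom_of (fpmor_id M)) f = f.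
Proof.
case: (fphom_of_surj f) => phi ->; rewrite fphom_comp_of.
by congr fphom_of; apply: val_inj; rewrite /= mul1mx.
Qed.

Lemma fphom_compm1 M N (f : fphom M N) :
  fphom_comp f (fphom_of (fpmor_id N)) = f.
Proof.
case: (fphom_of_surj f) => phi ->; rewrite fphom_comp_of.
by congr fphom_of; apply: val_inj; rewrite /= mulmx1.
Qed.

Lemma fphom_compDl M N L (f g : fphom M N) (h : fphom N L) :
  fphom_comp (f + g) h = fphom_comp f h + fphom_comp g h.
Proof.
case: (fphom_of_surj f) (fphom_of_surj g) (fphom_of_surj h)
  => phi -> [psi ->] [chi ->].
rewrite -fphom_ofD (fphom_comp_of phi) (fphom_comp_of psi) fphom_comp_of.
rewrite -fphom_ofD; congr fphom_of.
by apply: val_inj; rewrite /= mulmxDl.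
Qed.

Lemma fphom_compDr M N L (f : fphom M N) (g h : fphom N L) :
  fphom_comp f (g + h) = fphom_comp f g + fphom_comp f h.
Proof.
case: (fphom_of_surj f) (fphom_of_surj g) (fphom_of_surj h)
  => phi -> [psi ->] [chi ->].
rewrite -fphom_ofD (fphom_comp_of phi psi) (fphom_comp_of phi chi).
rewrite fphom_comp_of -fphom_ofD; congr fphom_of.
by apply: val_inj; rewrite /= mulmxDr.
Qed.

Definition fpres : preadditive := Preadditive
  fphom_compA fphom_comp1m fphom_compm1 fphom_compDl fphom_compDr.

(* An object is coded by a code of any matrix presenting it, a morphism by a code
   of any matrix inducing it. *)
Definition fpres_coding (rep : tree -> Q -> Prop) : coding fpres := @Coding fpres
  (fun t M => exists r c (A : 'M[Q]_(r, c)), mx_code rep t A /\ M = fpobj_of A)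
  (fun M N t f => exists2 phi : fpmor M N,
     mx_code rep t (fpmor_mx phi) & f = fphom_of phi).

End FPres.

(* Main.v *)
Require Import Defs.
From HB Require Import structures.
From mathcomp Require Import all_boot all_order all_algebra.
From mathcomp Require Import ring boolp zify.

Set Implicit Arguments.
Unset Strict Implicit.
Unset Printing Implicit Defensive.

Import GRing.Theory.
Local Open Scope ring_scope.

(** The category of finite presentations over a commutative ring Q is Abelian,
    and all its constructions are programs, as soon as two matrix problems over Q
    are solved by programs: generating the left kernel of A, and finding X with
    X A = B when such an X exists ([fpres_computable]).

    A cokernel of phi : M -> N is presented by phi stacked on N, and direct sums
    by block matrices.  A kernel takes two computations of syzygies: the first
    block X1 of the syzygies of phi stacked on N generates the rows that phi maps
    into the relations of N, and the first block of the syzygies of X1 stacked on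
    M presents the module that these rows generate ([lsubmx_syzygies],
    [is_kernel_ker]).  A kernel lift solves Z X1 = tau; a colift is the given
    matrix.  The free module on the generators of M covers M.

    For projective lifts, the free cover of a projective coker P splits, which
    says that P Y P = P for some Y ([projective_regular]).  Then 1 - Y P maps the
    relations of P to 0, so it turns any matrix that lifts phi along eps on the
    generators, found by solving one linear system, into a morphism that lifts phi
    ([regular_liftP]).  The equation P Y P = P is linear in the entries of Y; as Q
    is commutative, it is a system with a single right-hand row ([mul_kron]).

    Both matrix problems over the local ring reduce to R.  Multiplying the columns
    of a matrix by units clears denominators without changing the left kernel or
    the solutions, and localization is flat, so syzygies over R serve over the
    local ring ([loc_syzygies]).  A row b is a combination of the rows of A after
    localization iff s b is one over R for some s outside m, iff b lies in
    span(A) + m b, since 1 is in R s + m.  This last condition is one linear system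
    over R, whose rows are the m_l b and those of A, and a solution of it reads
    (1 + t_1 m_1 + ... + t_k m_k) b = - T A, with an invertible coefficient on the
    left ([computes_local_solve_row]).

    What is left is to write the programs.  The relation [computes] is used as a
    weakest precondition, all loops are instances of one bounded loop with an
    invariant ([computes_for]), and a matrix is built from a program for its
    entries ([computes_mx]). *)

(** * Reasoning about programs *)

Lemma computes_weaken p x (P Q : tree -> Prop) :
  computes p x P -> (forall y, P y -> Q y) -> computes p x Q.
Proof. by case=> y ry Py PQ; exists y => //; apply: PQ. Qed.

(** Keeps the run itself, for a value that a second program recomputes. *)
Lemma computes_run p x (P : tree -> Prop) :
  computes p x P -> computes p x (fun y => run p x y /\ P y).
Proof. by case=> y ry Py; exists y. Qed.

Lemma computes_id x (P : tree -> Prop) : P x -> computes PId x P.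
Proof. by exists x => //; constructor. Qed.

Lemma computes_leaf x (P : tree -> Prop) : P Leaf -> computes PLeaf x P.
Proof. by exists Leaf => //; constructor. Qed.

Lemma computes_hd x (P : tree -> Prop) : P (hd_tree x) -> computes PHd x P.
Proof. by exists (hd_tree x) => //; constructor. Qed.

Lemma computes_tl x (P : tree -> Prop) : P (tl_tree x) -> computes PTl x P.
Proof. by exists (tl_tree x) => //; constructor. Qed.

Lemma computes_node p q x (P : tree -> Prop) :
  computes p x (fun y => computes q x (fun z => P (Node y z))) ->
  computes (PNode p q) x P.
Proof.
by case=> y ry [z rz Pyz]; exists (Node y z) => //; apply: run_node.
Qed.

Lemma computes_seq p q x (P : tree -> Prop) :
  computes p x (fun y => computes q y P) -> computes (PSeq p q) x P.
Proof. by case=> y ry [z rz Pz]; exists z => //; apply: run_seq rz. Qed.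

Lemma computes_if c p q x (P : tree -> Prop) :
  computes c x (fun v => if v is Leaf then computes q x P else computes p x P) ->
  computes (PIf c p q) x P.
Proof.
case=> -[|a b] rv [y ry Py]; exists y => //; first exact: run_if_false ry.
exact: run_if_true rv ry.
Qed.

Fixpoint PConst (t : tree) : prog :=
  if t is Node a b then PNode (PConst a) (PConst b) else PLeaf.

Lemma computes_const t x (P : tree -> Prop) : P t -> computes (PConst t) x P.
Proof.
exists t => //; elim: t {H} => [|a iha b ihb] /=; first exact: run_leaf.
exact: run_node.
Qed.

(** The input of a program is used as an environment: a list of values, in which
    variables are addressed by position (de Bruijn indices). *)
Fixpoint PVar (n : nat) : prog := if n is n'.+1 then PSeq PTl (PVar n') else PHd.

Fixpoint tree_nth (n : nat) (x : tree) : tree :=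
  if n is n'.+1 then tree_nth n' (tl_tree x) else hd_tree x.

Lemma computes_var n x (P : tree -> Prop) : P (tree_nth n x) -> computes (PVar n) x P.
Proof.
elim: n x => [|n ihn] x /= Px; first exact: computes_hd.
by apply: computes_seq; apply: computes_tl; apply: ihn.
Qed.

Fixpoint PList (ps : seq prog) : prog :=
  if ps is p :: ps' then PNode p (PList ps') else PLeaf.

Lemma computes_list_cons p ps x (P : tree -> Prop) :
  computes p x (fun y => computes (PList ps) x (fun z => P (Node y z))) ->
  computes (PList (p :: ps)) x P.
Proof. exact: computes_node. Qed.

Lemma computes_list_nil x (P : tree -> Prop) : P Leaf -> computes (PList [::]) x P.
Proof. exact: computes_leaf. Qed.

Definition PCall p ps := PSeq (PList ps) p.

Lemma computes_call p ps x (P : tree -> Prop) :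
  computes (PList ps) x (fun y => computes p y P) -> computes (PCall p ps) x P.
Proof. exact: computes_seq. Qed.

Definition PLet p q := PSeq (PNode p PId) q.

Lemma computes_let p q x (P : tree -> Prop) :
  computes p x (fun y => computes q (Node y x) P) -> computes (PLet p q) x P.
Proof.
move=> h; apply/computes_seq/computes_node; apply: computes_weaken h _ => y h.
exact: computes_id.
Qed.

Arguments nat_tree : simpl never.
Arguments PConst : simpl never.
Arguments PVar : simpl never.
Arguments PList : simpl never.

Lemma nat_treeS n : nat_tree n.+1 = Node Leaf (nat_tree n). Proof. by []. Qed.

Lemma nat_tree_inj : injective nat_tree.
Proof. by elim=> [|m ihm] [|n] //; rewrite !nat_treeS => -[/ihm ->]. Qed.

Lemma list_tree_inj : injective list_tree.
Proof. by elim=> [|a s ihs] [|b t] //= [-> /ihs ->]. Qed.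

(** Bounded loop.  The counter runs downwards because a unary number gives access
    to its predecessor only.  The state of the underlying loop is the triple of the
    counter, the accumulator and the environment; [step] sees the index and the
    accumulator as variables 0 and 1, in front of the environment. *)
Definition PFor pn init step : prog :=
  PSeq (PNode pn (PNode init PId))
    (PSeq (PWhile PHd
             (PNode (PSeq PHd PTl)
               (PNode (PSeq (PNode (PSeq PHd PTl) PTl) step) (PSeq PTl PTl))))
          (PVar 1)).

Lemma computes_for n (I : nat -> tree -> Prop) pn init step x (P : tree -> Prop) :
  computes pn x (eq (nat_tree n)) -> computes init x (I n) ->
  (forall i acc, (i < n)%N -> I i.+1 acc ->
     computes step (Node (nat_tree i) (Node acc x)) (I i)) ->
  (forall y, I 0%N y -> P y) ->
  computes (PFor pn init step) x P.
Proof.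
move=> hn h0 hstep hP; apply/computes_seq/computes_node.
apply: computes_weaken hn _ => _ <-; apply: computes_node.
apply: computes_weaken h0 _ => acc hacc; apply: computes_id; apply: computes_seq.
suff [y ry Iy] : computes (PWhile PHd
             (PNode (PSeq PHd PTl)
               (PNode (PSeq (PNode (PSeq PHd PTl) PTl) step) (PSeq PTl PTl))))
    (Node (nat_tree n) (Node acc x))
    (fun y => exists2 a, I 0%N a & y = Node Leaf (Node a x)).
  exists y => //; case: Iy => a Ia ->; apply: computes_var; exact: hP.
clear hP pn init.
elim: n acc hacc hstep => [|n ihn] acc hacc hstep.
  by exists (Node Leaf (Node acc x)); [apply: run_while_false; constructor | exists acc].
have [|acc' racc hacc'] := hstep n acc _ hacc; first exact: ltnSn.
have [|y ry Iy] := ihn acc' hacc'; first by move=> i a /ltnW; apply: hstep.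
exists y => //; rewrite nat_treeS; apply: run_while_true ry.
  exact: run_hd.
have run_i : run (PSeq PHd PTl) (Node (Node Leaf (nat_tree n)) (Node acc x)) (nat_tree n).
  by apply: run_seq (run_hd _) (run_tl _).
apply: run_node => //; apply: run_node; last exact: run_seq (run_tl _) (run_tl _).
apply: run_seq racc; apply: run_node => //; exact: run_tl.
Qed.

Lemma computes_for_iter n f pn init step x a (P : tree -> Prop) :
  computes pn x (eq (nat_tree n)) -> computes init x (eq a) ->
  (forall i acc, computes step (Node (nat_tree i) (Node acc x)) (eq (f acc))) ->
  P (iter n f a) ->
  computes (PFor pn init step) x P.
Proof.
move=> hn h0 hs hP.
apply: (computes_for (I := fun i acc => acc = iter (n - i) f a) hn).
- by apply: computes_weaken h0 _ => _ <-; rewrite subnn.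
- move=> i acc lin ->; apply: computes_weaken (hs i _) _ => _ <-.
  by rewrite -iterS -subSn // subSS.
- by move=> _ ->; rewrite subn0.
Qed.

(** The downward count produces the last entry first, which is the order in which
    a list is consed up. *)
Definition PTab pn p : prog :=
  PFor pn PLeaf (PNode (PSeq (PNode PHd (PSeq PTl PTl)) p) (PVar 1)).

Lemma computes_tab n (Q : 'I_n -> tree -> Prop) pn p x (P : tree -> Prop) :
  computes pn x (eq (nat_tree n)) ->
  (forall i : 'I_n, computes p (Node (nat_tree i) x) (Q i)) ->
  (forall f : 'I_n -> tree, (forall i, Q i (f i)) ->
     P (list_tree [seq f i | i <- enum 'I_n])) ->
  computes (PTab pn p) x P.
Proof.
move=> hn hp hP.
pose I c acc := exists2 f : nat -> tree,
  acc = list_tree [seq f i | i <- iota c (n - c)] &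
  forall i : 'I_n, (c <= i)%N -> Q i (f i).
apply: (computes_for (I := I) hn).
- apply: computes_leaf; exists (fun=> Leaf); first by rewrite subnn.
  by move=> i; rewrite leqNgt ltn_ord.
- move=> i _ lin [f -> hf]; apply/computes_node/computes_seq/computes_node.
  apply/computes_hd/computes_seq/computes_tl/computes_tl => /=.
  apply: computes_weaken (hp (Ordinal lin)) _ => y Qy; apply: computes_var => /=.
  exists (fun j => if j == i then y else f j).
    rewrite -(subnSK lin) /= eqxx; congr (Node _ (list_tree _)).
    apply/eq_in_map => j; rewrite mem_iota => /andP[lij _].
    by rewrite gtn_eqF.
  move=> j; rewrite leq_eqVlt; have [eji|nji] := eqVneq (j : nat) i.
    by move=> _; have -> : j = Ordinal lin by apply: val_inj.
  by rewrite ?(negPf nji) => /hf.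
- move=> _ [f -> hf]; rewrite subn0 -val_enum_ord -map_comp.
  by apply: (hP (f \o val)) => i; apply: hf.
Qed.

(** Weakest preconditions of loop-free code. *)
Ltac wp_base_step := lazymatch goal with
  | |- computes (PSeq _ _) _ _ => apply: computes_seq
  | |- computes (PNode _ _) _ _ => apply: computes_node
  | |- computes (PCall _ _) _ _ => apply: computes_call
  | |- computes (PLet _ _) _ _ => apply: computes_let
  | |- computes (PList (_ :: _)) _ _ => apply: computes_list_cons
  | |- computes (PList [::]) _ _ => apply: computes_list_nil; cbv beta
  | |- computes (PIf _ _ _) _ _ => apply: computes_if
  | |- computes (PVar _) _ _ => apply: computes_var => /=
  | |- computes (PConst _) _ _ => apply: computes_const => /=
  | |- computes PId _ _ => apply: computes_id => /=
  | |- computes PHd _ _ => apply: computes_hd => /=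
  | |- computes PTl _ _ => apply: computes_tl => /=
  | |- computes PLeaf _ _ => apply: computes_leaf => /=
  end.
Ltac wp_base := repeat wp_base_step; try reflexivity.

(** * Numbers and matrices as data *)

Definition PDrop pi pl := PFor pi pl (PSeq (PVar 1) PTl).

Lemma computes_drop i t pi pl x (P : tree -> Prop) :
  computes pi x (eq (nat_tree i)) -> computes pl x (eq t) ->
  P (iter i tl_tree t) -> computes (PDrop pi pl) x P.
Proof. by move=> hi hl hP; apply: computes_for_iter hi hl _ hP => j acc; wp_base. Qed.

Lemma iter_tl_list i s : iter i tl_tree (list_tree s) = list_tree (drop i s).
Proof.
elim: i s => [|i ihi] s; first by rewrite drop0.
by rewrite iterSr; case: s => [|a s]; rewrite /= ?ihi //; apply: ihi [::].
Qed.

Lemma iter_tl_nat i n : iter i tl_tree (nat_tree n) = nat_tree (n - i).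
Proof. by rewrite /nat_tree iter_tl_list drop_nseq. Qed.

(** Dropping i elements of the unary number n leaves a non-empty tree iff i < n. *)
Definition PIfLt pi pn p q := PIf (PDrop pi pn) p q.

Lemma computes_if_lt i n pi pn p q x (P : tree -> Prop) :
  computes pi x (eq (nat_tree i)) -> computes pn x (eq (nat_tree n)) ->
  (if (i < n)%N then computes p x P else computes q x P) ->
  computes (PIfLt pi pn p q) x P.
Proof.
move=> hi hn hP; apply/computes_if/(computes_drop hi hn).
rewrite iter_tl_nat; case: ltnP hP => [lin|/eqP ->] //.
by rewrite -subn_gt0 in lin; case: (n - i)%N lin.
Qed.

Definition PIfEq pi pj p q := PIfLt pi pj q (PIfLt pj pi q p).

Lemma computes_if_eq i j pi pj p q x (P : tree -> Prop) :
  computes pi x (eq (nat_tree i)) -> computes pj x (eq (nat_tree j)) ->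
  (if i == j then computes p x P else computes q x P) ->
  computes (PIfEq pi pj p q) x P.
Proof.
move=> hi hj hP; apply: (computes_if_lt hi hj).
case: ltngtP hP => [lij|gij|eij] hP //; apply: (computes_if_lt hj hi).
  by rewrite gij.
by rewrite eij ltnn.
Qed.

Definition PAddn pi pj := PFor pi pj (PNode PLeaf (PVar 1)).

Lemma computes_addn i j pi pj x (P : tree -> Prop) :
  computes pi x (eq (nat_tree i)) -> computes pj x (eq (nat_tree j)) ->
  P (nat_tree (i + j)) -> computes (PAddn pi pj) x P.
Proof.
move=> hi hj hP.
apply: (computes_for_iter (f := Node Leaf) hi hj) => [k acc|]; first by wp_base.
suff -> : iter i (Node Leaf) (nat_tree j) = nat_tree (i + j) by [].
by elim: i {hi hP} => //= i ->.
Qed.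

Definition PMuln pi pj := PFor pi PLeaf (PAddn (PSeq (PSeq PTl PTl) pj) (PVar 1)).

Lemma computes_muln i j pi pj x (P : tree -> Prop) :
  computes pi x (eq (nat_tree i)) -> computes pj x (eq (nat_tree j)) ->
  P (nat_tree (i * j)) -> computes (PMuln pi pj) x P.
Proof.
move=> hi hj hP.
apply: (computes_for (I := fun k acc => acc = nat_tree ((i - k) * j)) hi).
- by wp_base; rewrite subnn.
- move=> k _ lki ->; apply: computes_addn; [by wp_base; exact: hj| by wp_base |].
  by rewrite -mulSn -subSn // subSS.
- by move=> _ ->; rewrite subn0.
Qed.

(** The pair (quotient, remainder) is counted up l times from (0, 0), with a carry
    when the remainder reaches n. *)
Definition PDivMod pl pn :=
  PFor pl (PNode PLeaf PLeaf)
    (PIfLt (PNode PLeaf (PSeq (PVar 1) PTl)) (PSeq (PSeq PTl PTl) pn)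
       (PNode (PSeq (PVar 1) PHd) (PNode PLeaf (PSeq (PVar 1) PTl)))
       (PNode (PNode PLeaf (PSeq (PVar 1) PHd)) PLeaf)).

Lemma computes_divmod l n pl pn x (P : tree -> Prop) :
  (0 < n)%N ->
  computes pl x (eq (nat_tree l)) -> computes pn x (eq (nat_tree n)) ->
  P (Node (nat_tree (l %/ n)) (nat_tree (l %% n))) -> computes (PDivMod pl pn) x P.
Proof.
move=> n0 hl hn hP.
pose I k acc := acc = Node (nat_tree ((l - k) %/ n)) (nat_tree ((l - k) %% n)).
apply: (computes_for (I := I) hl).
- by wp_base; rewrite /I subnn div0n mod0n.
- move=> k _ lkl ->; rewrite /I -(subnSK lkl); set m := (l - k.+1)%N.
  apply: (@computes_if_lt (m %% n).+1 n); [by wp_base | by wp_base; exact: hn |].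
  have em : m.+1 = (m %/ n * n + (m %% n).+1)%N by rewrite addnS -divn_eq.
  rewrite em; case: ltnP => [ltn|].
    wp_base; rewrite divnMDl // modnMDl [(_.+1 %/ _)%N]divn_small // addn0.
    by rewrite [(_.+1 %% _)%N]modn_small.
  move=> le_n; have {le_n} -> : (m %% n).+1 = n.
    by apply/eqP; rewrite eqn_leq le_n ltn_pmod.
  by wp_base; rewrite divnMDl // divnn n0 addn1 modnMDl modnn.
- by move=> _ ->; rewrite subn0.
Qed.

Definition PNth pl pi := PSeq (PDrop pi pl) PHd.

Lemma computes_nth n (f : 'I_n -> tree) (i : 'I_n) pl pi x (P : tree -> Prop) :
  computes pl x (eq (list_tree [seq f i | i <- enum 'I_n])) ->
  computes pi x (eq (nat_tree i)) ->
  P (f i) -> computes (PNth pl pi) x P.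
Proof.
move=> hl hi hP; apply/computes_seq/(computes_drop hi hl)/computes_hd.
have lt_i : (i < size [seq f i | i <- enum 'I_n])%N by rewrite size_map size_enum_ord.
rewrite iter_tl_list (drop_nth Leaf lt_i) /=.
by rewrite (nth_map i) ?size_enum_ord // nth_ord_enum.
Qed.

Definition PRows a := PSeq a PHd.
Definition PCols a := PSeq a (PVar 1).
Definition PEntry a pi pj := PNth (PNth (PSeq a (PVar 2)) pi) pj.
(** The program for the entries sees the column index as variable 0 and the row
    index as variable 1, in front of the environment. *)
Definition PMx pr pc pe :=
  PList [:: pr; pc; PTab pr (PTab (PSeq PTl pc) pe)].

Section MatrixCodes.
Variables (T : Type) (rep : tree -> T -> Prop).

Section Access.
Variables (r c : nat) (A : 'M[T]_(r, c)) (t : tree) (a : prog) (x : tree).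
Hypotheses (ha : computes a x (eq t)) (hA : mx_code rep t A).

Lemma computes_nrows (P : tree -> Prop) :
  P (nat_tree r) -> computes (PRows a) x P.
Proof.
case: hA => E _ et hP; apply: computes_seq; apply: computes_weaken ha _ => _ <-.
by rewrite et; apply: computes_hd.
Qed.

Lemma computes_ncols (P : tree -> Prop) :
  P (nat_tree c) -> computes (PCols a) x P.
Proof.
case: hA => E _ et hP; apply: computes_seq; apply: computes_weaken ha _ => _ <-.
by rewrite et; apply: computes_var.
Qed.

Lemma computes_entry pi pj (i : 'I_r) (j : 'I_c) (P : tree -> Prop) :
  computes pi x (eq (nat_tree i)) -> computes pj x (eq (nat_tree j)) ->
  (forall d, rep d (A i j) -> P d) -> computes (PEntry a pi pj) x P.
Proof.
case: hA => E hE et hi hj hP.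
apply: (computes_nth (f := E i) (i := j)) hj (hP _ (hE i j)).
pose f i := list_tree [seq E i j | j <- enum 'I_c].
apply: (computes_nth (f := f) (i := i)) hi _ => //.
apply: computes_seq; apply: computes_weaken ha _ => _ <-; rewrite et.
exact: computes_var.
Qed.

End Access.

(** A matrix may be built row by row when one computation yields a whole row. *)
Lemma computes_mx_rows r c (A : 'M[T]_(r, c)) pr pc pw x (P : tree -> Prop) :
  computes pr x (eq (nat_tree r)) -> computes pc x (eq (nat_tree c)) ->
  (forall i : 'I_r, computes pw (Node (nat_tree i) x) (fun d =>
     exists f, d = list_tree [seq f j | j <- enum 'I_c] /\
       forall j, rep (f j) (A i j))) ->
  (forall d, mx_code rep d A -> P d) ->
  computes (PList [:: pr; pc; PTab pr pw]) x P.
Proof.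
move=> hr hc hw hP; wp_base_step; apply: computes_weaken (hr) _ => _ <-.
wp_base_step; apply: computes_weaken hc _ => _ <-; wp_base_step.
apply: (computes_tab (n := r) hr hw) => f /choice[E hE].
apply: computes_list_nil; apply: hP; exists E => [i j|]; first by case: (hE i).
suff -> : [seq f i | i <- enum 'I_r] =
  [seq list_tree [seq E i j | j <- enum 'I_c] | i <- enum 'I_r] by [].
by apply: eq_map => i; case: (hE i).
Qed.

Lemma computes_mx r c (A : 'M[T]_(r, c)) pr pc pe x (P : tree -> Prop) :
  computes pr x (eq (nat_tree r)) -> computes pc x (eq (nat_tree c)) ->
  (forall (i : 'I_r) (j : 'I_c),
     computes pe (Node (nat_tree j) (Node (nat_tree i) x))
       (fun d => rep d (A i j))) ->
  (forall d, mx_code rep d A -> P d) ->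
  computes (PMx pr pc pe) x P.
Proof.
move=> hr hc he hP; apply: (computes_mx_rows (A := A) hr hc) => // i.
apply: (computes_tab (n := c)) (he i) _ => [|f hf]; first by wp_base.
by exists f.
Qed.

Lemma mx_code_exists : (forall x, exists t, rep t x) ->
  forall r c (A : 'M[T]_(r, c)), exists t, mx_code rep t A.
Proof.
move=> /choice[f hf] r c A; eexists.
by exists (fun i j => f (A i j)) => // i j; apply: hf.
Qed.

(** The dimensions are part of the code, so that one code stands for matrices of
    one size only. *)
Lemma mx_code_inj : (forall t x y, rep t x -> rep t y -> x = y) ->
  forall r c r' c' (A : 'M[T]_(r, c)) (B : 'M[T]_(r', c')) t,
  mx_code rep t A -> mx_code rep t B ->
  exists (er : r = r') (ec : c = c'), castmx (er, ec) A = B.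
Proof.
move=> rep_inj r c r' c' A B t [E hE ->] [F hF] /list_tree_inj[].
move=> /nat_tree_inj er /nat_tree_inj ec; subst r' c' => /list_tree_inj eEF.
exists erefl, erefl; rewrite castmx_id; apply/matrixP => i j.
suff eij : E i j = F i j by apply: rep_inj (hE i j) _; rewrite eij.
have /eq_in_map/(_ i) := eEF; rewrite mem_enum => /(_ isT)/list_tree_inj.
by move=> /eq_in_map/(_ j); rewrite mem_enum; apply.
Qed.

End MatrixCodes.

Arguments PRows : simpl never.
Arguments PCols : simpl never.
Arguments PEntry : simpl never.
Arguments PMx : simpl never.

(** Also evaluates arithmetic on indices, dimensions, tests and entries; codes of
    matrices are looked up in the hypotheses, and the search stops at calls of
    other programs, where a specification has to be supplied. *)
Ltac wp_step := lazymatch goal with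
  | |- computes (PRows _) _ _ => eapply computes_nrows; [solve [wp] | eassumption | cbv beta]
  | |- computes (PCols _) _ _ => eapply computes_ncols; [solve [wp] | eassumption | cbv beta]
  | |- computes (PEntry _ _ _) _ _ =>
       eapply computes_entry;
         [solve [wp] | eassumption | solve [wp] | solve [wp] | cbv beta]
  | |- computes (PDrop _ _) _ _ => 
       eapply computes_drop; [solve [wp] | solve [wp] | rewrite ?iter_tl_nat /=]
  | |- computes (PAddn _ _) _ _ => eapply computes_addn; [solve [wp] | solve [wp] | cbv beta]
  | |- computes (PMuln _ _) _ _ => eapply computes_muln; [solve [wp] | solve [wp] | cbv beta]
  | |- computes (PIfLt _ _ _ _) _ _ => eapply computes_if_lt; [solve [wp] | solve [wp] | ]
  | |- computes (PIfEq _ _ _ _) _ _ => eapply computes_if_eq; [solve [wp] | solve [wp] | ]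
  | |- computes (PMx _ _ _) _ _ => 
       eapply computes_mx;
         [solve [wp] | solve [wp] | | cbv beta; try exact (fun _ h => h)]
  | |- _ => wp_base_step
  end
with wp := repeat wp_step; try reflexivity.

(** * Matrix programs *)

Section Blocks.
Variables (T : Type) (rep : tree -> T -> Prop).
Definition PColMx := PMx (PAddn (PRows (PVar 0)) (PRows (PVar 1))) (PCols (PVar 0))
  (PIfLt (PVar 1) (PRows (PVar 2)) (PEntry (PVar 2) (PVar 1) (PVar 0))
     (PEntry (PVar 3) (PDrop (PRows (PVar 2)) (PVar 1)) (PVar 0))).

Lemma computes_col_mx r1 r2 c (A : 'M[T]_(r1, c)) (B : 'M[T]_(r2, c)) t u :
  mx_code rep t A -> mx_code rep u B ->
  computes PColMx (list_tree [:: t; u]) (fun d => mx_code rep d (col_mx A B)).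
Proof.
move=> hA hB; rewrite /PColMx; wp => i j; wp; case: (split_ordP i) => k -> /=.
  by rewrite col_mxEu; wp.
by rewrite col_mxEd; apply: (computes_entry _ hB (i := k)) => //; wp; rewrite ?addKn.
Qed.

Definition PRowMx := PMx (PRows (PVar 0)) (PAddn (PCols (PVar 0)) (PCols (PVar 1)))
  (PIfLt (PVar 0) (PCols (PVar 2)) (PEntry (PVar 2) (PVar 1) (PVar 0))
     (PEntry (PVar 3) (PVar 1) (PDrop (PCols (PVar 2)) (PVar 0)))).

Lemma computes_row_mx r c1 c2 (A : 'M[T]_(r, c1)) (B : 'M[T]_(r, c2)) t u :
  mx_code rep t A -> mx_code rep u B ->
  computes PRowMx (list_tree [:: t; u]) (fun d => mx_code rep d (row_mx A B)).
Proof.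
move=> hA hB; rewrite /PRowMx; wp => i j; wp; case: (split_ordP j) => k -> /=.
  by rewrite row_mxEl; wp.
by rewrite row_mxEr; apply: (computes_entry _ hB (j := k)) => //; wp; rewrite ?addKn.
Qed.

Definition PLsubMx := PMx (PRows (PVar 0)) (PVar 1) (PEntry (PVar 2) (PVar 1) (PVar 0)).

Lemma computes_lsubmx r c1 c2 (A : 'M[T]_(r, c1 + c2)) t :
  mx_code rep t A ->
  computes PLsubMx (list_tree [:: t; nat_tree c1]) (fun d => mx_code rep d (lsubmx A)).
Proof.
move=> hA; rewrite /PLsubMx; wp => i j; rewrite mxE.
by apply: (computes_entry _ hA (j := lshift c2 j)) => //; wp.
Qed.
End Blocks.

Lemma computes_big (T : Type) (rep : tree -> T -> Prop) (idx : T)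
    (op : Monoid.com_law idx) n (F : 'I_n -> T) pop tidx pn p x (P : tree -> Prop) :
  rep tidx idx ->
  (forall t u a b, rep t a -> rep u b ->
     computes pop (list_tree [:: t; u]) (fun d => rep d (op a b))) ->
  computes pn x (eq (nat_tree n)) ->
  (forall (k : 'I_n) acc, computes p (Node (nat_tree k) (Node acc x)) (fun d => rep d (F k))) ->
  (forall d, rep d (\big[op/idx]_(k < n) F k) -> P d) ->
  computes (PFor pn (PConst tidx) (PCall pop [:: p; PVar 1])) x P.
Proof.
move=> hidx hop hn hp hP.
pose I c acc := rep acc (\big[op/idx]_(k < n | (c <= k)%N) F k).
apply: (computes_for (I := I) hn) => [|i acc lin Iacc|y]; last exact: hP.
  apply: computes_const; rewrite /I big_pred0 // => k.
  by rewrite leqNgt ltn_ord.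
do 2!wp_base_step; apply: computes_weaken (hp (Ordinal lin) acc) _ => y hy; wp_base => /=.
apply: computes_weaken (hop _ _ _ _ hy Iacc) _ => d.
rewrite /I [in X in _ -> X](bigD1 (Ordinal lin)) //=.
by congr (rep _ (op _ _)); apply: eq_bigl => k; rewrite ltn_neqAle andbC eq_sym.
Qed.

Record ring_progs := RingProgs {
  zero_t : tree; one_t : tree; add_p : prog; opp_p : prog; mul_p : prog }.

Record ring_progs_spec (Q : pzRingType) (rep : tree -> Q -> Prop) (ar : ring_progs) : Prop := {
  zero_tP : rep (zero_t ar) 0;
  one_tP : rep (one_t ar) 1;
  add_pP : forall t u x y, rep t x -> rep u y ->
    computes (add_p ar) (list_tree [:: t; u]) (fun d => rep d (x + y));
  opp_pP : forall t x, rep t x -> computes (opp_p ar) t (fun d => rep d (- x));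
  mul_pP : forall t u x y, rep t x -> rep u y ->
    computes (mul_p ar) (list_tree [:: t; u]) (fun d => rep d (x * y)) }.

Section RingMatrices.
Variables (Q : pzRingType) (rep : tree -> Q -> Prop) (ar : ring_progs).
Hypothesis arP : ring_progs_spec rep ar.

Definition PZeroMx := PMx (PVar 0) (PVar 1) (PConst (zero_t ar)).

Lemma computes_zero_mx r c :
  computes PZeroMx (list_tree [:: nat_tree r; nat_tree c])
    (fun d => mx_code rep d (0 : 'M_(r, c))).
Proof.
by rewrite /PZeroMx; wp => i j; wp; rewrite mxE; apply: zero_tP.
Qed.

Definition PIdMx := PMx (PVar 0) (PVar 0)
  (PIfEq (PVar 1) (PVar 0) (PConst (one_t ar)) (PConst (zero_t ar))).

Lemma computes_id_mx n :
  computes PIdMx (list_tree [:: nat_tree n]) (fun d => mx_code rep d (1%:M : 'M_n)).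
Proof.
rewrite /PIdMx; wp => i j; wp; rewrite mxE -val_eqE /=.
by case: eqP => _; wp; [apply: one_tP | apply: zero_tP].
Qed.

Definition PAddMx := PMx (PRows (PVar 0)) (PCols (PVar 0))
  (PCall (add_p ar) [:: PEntry (PVar 2) (PVar 1) (PVar 0);
                        PEntry (PVar 3) (PVar 1) (PVar 0)]).

Lemma computes_add_mx r c (A B : 'M_(r, c)) t u :
  mx_code rep t A -> mx_code rep u B ->
  computes PAddMx (list_tree [:: t; u]) (fun d => mx_code rep d (A + B)).
Proof.
move=> hA hB; rewrite /PAddMx; wp => i j; wp => a ha; wp => b hb; wp.
by rewrite mxE; apply: add_pP.
Qed.

Definition POppMx := PMx (PRows PId) (PCols PId)
  (PSeq (PEntry (PSeq PTl PTl) (PVar 1) (PVar 0)) (opp_p ar)).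

Lemma computes_opp_mx r c (A : 'M_(r, c)) t :
  mx_code rep t A -> computes POppMx t (fun d => mx_code rep d (- A)).
Proof.
move=> hA; rewrite /POppMx; wp => i j; wp => a ha.
by rewrite mxE; apply: opp_pP.
Qed.

Definition PMulMx := PMx (PRows (PVar 0)) (PCols (PVar 1))
  (PFor (PCols (PVar 2)) (PConst (zero_t ar)) (PCall (add_p ar)
     [:: PCall (mul_p ar) [:: PEntry (PVar 4) (PVar 3) (PVar 0);
                              PEntry (PVar 5) (PVar 0) (PVar 2)];
         PVar 1])).

Lemma computes_mul_mx r n c (A : 'M_(r, n)) (B : 'M_(n, c)) t u :
  mx_code rep t A -> mx_code rep u B ->
  computes PMulMx (list_tree [:: t; u]) (fun d => mx_code rep d (A *m B)).
Proof.
move=> hA hB; rewrite /PMulMx; wp => i j.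
apply: (@computes_big _ rep 0 +%R n (fun k => A i k * B k j)).
- exact: zero_tP.
- by move=> *; apply: add_pP.
- by wp.
- by move=> k acc; wp => a ha; wp => b hb; wp; apply: mul_pP.
- by move=> d; rewrite mxE.
Qed.

End RingMatrices.

(** * The equation P Y P = P as a linear system with one row *)

Definition PDiv pl pn := PSeq (PDivMod pl pn) PHd.
Definition PMod pl pn := PSeq (PDivMod pl pn) PTl.

Section Kronecker.

(** Pairs of indices are numbered through quotient and remainder, so that programs
    can pass between a pair and its number. *)
Section PairIndex.
Variables (m n : nat).

Lemma ord_quot_subproof (l : 'I_(m * n)) : (l %/ n < m)%N.
Proof. by case: n l => [|n'] [l /= lmn]; rewrite ?muln0 // in lmn *; rewrite ltn_divLR. Qed.
Definition ord_quot (l : 'I_(m * n)) : 'I_m := Ordinal (ord_quot_subproof l).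

Lemma ord_rem_subproof (l : 'I_(m * n)) : (l %% n < n)%N.
Proof. by case: n l => [|n'] [l /= lmn]; rewrite ?muln0 // in lmn *; rewrite ltn_mod. Qed.
Definition ord_rem (l : 'I_(m * n)) : 'I_n := Ordinal (ord_rem_subproof l).

Lemma ord_pair_subproof (a : 'I_m) (b : 'I_n) : (a * n + b < m * n)%N.
Proof. by have := ltn_ord a; have := ltn_ord b; nia. Qed.
Definition ord_pair (a : 'I_m) (b : 'I_n) : 'I_(m * n) := Ordinal (ord_pair_subproof a b).

Lemma ord_quot_pair a b : ord_quot (ord_pair a b) = a.
Proof.
apply: val_inj; rewrite /= divnMDl ?divn_small ?addn0 //.
by apply: leq_ltn_trans (ltn_ord b).
Qed.

Lemma ord_rem_pair a b : ord_rem (ord_pair a b) = b.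
Proof. by apply: val_inj; rewrite /= modnMDl modn_small. Qed.

Lemma ord_pairK l : ord_pair (ord_quot l) (ord_rem l) = l.
Proof. by apply: val_inj; rewrite /= -divn_eq. Qed.

Lemma sum_ord_pair (V : nmodType) (F : 'I_(m * n) -> V) :
  \sum_l F l = \sum_a \sum_b F (ord_pair a b).
Proof.
rewrite pair_big /=; apply: (reindex (fun p => ord_pair p.1 p.2)).
exists (fun l => (ord_quot l, ord_rem l)) => [[a b] _|l _] /=.
  by rewrite ord_quot_pair ord_rem_pair.
exact: ord_pairK.
Qed.

Lemma computes_div (l : 'I_(m * n)) pl pn x (P : tree -> Prop) :
  computes pl x (eq (nat_tree l)) -> computes pn x (eq (nat_tree n)) ->
  P (nat_tree (ord_quot l)) -> computes (PDiv pl pn) x P.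
Proof.
move=> hl hn hP; apply/computes_seq/(computes_divmod _ hl hn); last exact: computes_hd.
by apply: leq_ltn_trans (ltn_ord (ord_rem l)).
Qed.

Lemma computes_mod (l : 'I_(m * n)) pl pn x (P : tree -> Prop) :
  computes pl x (eq (nat_tree l)) -> computes pn x (eq (nat_tree n)) ->
  P (nat_tree (ord_rem l)) -> computes (PMod pl pn) x P.
Proof.
move=> hl hn hP; apply/computes_seq/(computes_divmod _ hl hn); last exact: computes_tl.
by apply: leq_ltn_trans (ltn_ord (ord_rem l)).
Qed.

End PairIndex.

Section Vec.
Variables (Q : comPzRingType) (r c : nat).
Implicit Types P : 'M[Q]_(r, c).

(** The Kronecker product of the transpose of P with P, which is the matrix of
    Y |-> P Y P on matrices flattened to rows. *)
Definition kron P : 'M[Q]_(c * r, r * c) :=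
  \matrix_(l, m) (P (ord_quot m) (ord_quot l) * P (ord_rem l) (ord_rem m)).
Definition vec P : 'rV[Q]_(r * c) := \row_m P (ord_quot m) (ord_rem m).
Definition unvec (y : 'rV[Q]_(r * c)) := \matrix_(a < r, b < c) y 0 (ord_pair a b).

Lemma vecK P : unvec (vec P) = P.
Proof. by apply/matrixP => i j; rewrite !mxE ord_quot_pair ord_rem_pair. Qed.
End Vec.

(** Commutativity lets both factors P stand on the right of the entries of Y. *)
Lemma mul_kron (Q : comPzRingType) r c (P : 'M[Q]_(r, c)) (y : 'rV[Q]_(c * r)) :
  y *m kron P = vec (P *m unvec y *m P).
Proof.
apply/rowP => m; rewrite !mxE sum_ord_pair exchange_big; apply: eq_bigr => b _.
rewrite !mxE big_distrl; apply: eq_bigr => a _ /=.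
by rewrite !mxE ord_quot_pair ord_rem_pair mulrA [y 0 _ * _]mulrC.
Qed.

Variables (Q : comPzRingType) (rep : tree -> Q -> Prop) (ar : ring_progs).
Hypothesis arP : ring_progs_spec rep ar.

Definition PKron :=
  PMx (PMuln (PCols (PVar 0)) (PRows (PVar 0))) (PMuln (PRows (PVar 0)) (PCols (PVar 0)))
   (PCall (mul_p ar)
      [:: PEntry (PVar 2) (PDiv (PVar 0) (PCols (PVar 2))) (PDiv (PVar 1) (PRows (PVar 2)));
          PEntry (PVar 2) (PMod (PVar 1) (PRows (PVar 2))) (PMod (PVar 0) (PCols (PVar 2)))]).

Lemma computes_kron r c (P : 'M_(r, c)) t : mx_code rep t P ->
  computes PKron (list_tree [:: t]) (fun d => mx_code rep d (kron P)).
Proof.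
move=> hP; rewrite /PKron; wp => l m; wp.
apply: (computes_entry _ hP (i := ord_quot m) (j := ord_quot l)) => [|||a ha].
- by wp.
- by apply: computes_div; wp.
- by apply: computes_div; wp.
wp; apply: (computes_entry _ hP (i := ord_rem l) (j := ord_rem m)) => [|||b hb].
- by wp.
- by apply: computes_mod; wp.
- by apply: computes_mod; wp.
by wp; rewrite mxE; apply: mul_pP.
Qed.

Definition PVec :=
  PMx (PConst (nat_tree 1)) (PMuln (PRows (PVar 0)) (PCols (PVar 0)))
   (PEntry (PVar 2) (PDiv (PVar 0) (PCols (PVar 2))) (PMod (PVar 0) (PCols (PVar 2)))).

Lemma computes_vec r c (P : 'M_(r, c)) t : mx_code rep t P ->
  computes PVec (list_tree [:: t]) (fun d => mx_code rep d (vec P)).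
Proof.
move=> hP; rewrite /PVec; wp => i m; rewrite mxE.
apply: (computes_entry _ hP (i := ord_quot m) (j := ord_rem m)) => //.
- by wp.
- by apply: computes_div; wp.
- by apply: computes_mod; wp.
Qed.

Definition PUnvec := PMx (PVar 1) (PVar 2)
  (PEntry (PVar 2) (PConst (nat_tree 0)) (PAddn (PMuln (PVar 1) (PVar 4)) (PVar 0))).

Lemma computes_unvec r c (y : 'rV_(r * c)) t : mx_code rep t y ->
  computes PUnvec (list_tree [:: t; nat_tree r; nat_tree c])
    (fun d => mx_code rep d (unvec y)).
Proof.
move=> hy; rewrite /PUnvec; wp => i j; rewrite mxE.
by apply: (computes_entry _ hy (i := 0) (j := ord_pair i j)) => //; wp.
Qed.

End Kronecker.

(** * The category of finite presentations *)

Arguments rels {Q} M _ : rename.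

Section Preadditive.
Variable C : preadditive.

Lemma compm0 (M N L : C) (f : Defs.hom M N) : f ;; 0 = (0 : Defs.hom M L).
Proof. by apply: (addrI (f ;; 0)); rewrite -compDr !addr0. Qed.

Lemma comp0m (M N L : C) (f : Defs.hom N L) : 0 ;; f = (0 : Defs.hom M L).
Proof. by apply: (addrI (0 ;; f)); rewrite -compDl !addr0. Qed.

End Preadditive.

Section FinitePresentations.
Variable Q : pzRingType.
Implicit Types M N L K P : fpobj Q.

Lemma relsN M u : rels M u -> rels M (- u).
Proof. by move=> hu; rewrite -sub0r; apply: relsB hu; apply: rels0. Qed.

Lemma relsD M u v : rels M u -> rels M v -> rels M (u + v).
Proof. by move=> hu /relsN hv; rewrite -[v]opprK; apply: relsB. Qed.

Lemma rels_congr M u v : rels M (u - v) -> rels M v -> rels M u.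
Proof. by move=> huv hv; rewrite -(subrK v u); apply: relsD. Qed.

Lemma rels_congr_sym M u v : rels M (u - v) -> rels M (v - u).
Proof. by move/relsN; rewrite opprB. Qed.

Lemma rows_factor m n r (W : 'M[Q]_(m, n)) (A : 'M[Q]_(r, n)) :
  (forall i, exists y, row i W = y *m A) -> exists Z, W = Z *m A.
Proof.
move=> /choice[f hf]; exists (\matrix_i f i).
by apply/row_matrixP => i; rewrite hf row_mul rowK.
Qed.

Lemma mulmx_factor m n r (W : 'M[Q]_(m, n)) (A : 'M[Q]_(r, n)) :
  (forall x : 'rV_m, exists y, x *m W = y *m A) -> exists Z, W = Z *m A.
Proof.
by move=> h; apply: rows_factor => i; have [y hy] := h (delta_mx 0 i); exists y; rewrite rowE.
Qed.

Lemma rels_mulmx M n (W : 'M_(n, gens M)) :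
  (forall i, rels M (row i W)) -> forall x, rels M (x *m W).
Proof.
case: M W => c U [r [A eU]] W /=; rewrite eU => /rows_factor[Z ->] x.
by exists (x *m Z); rewrite mulmxA.
Qed.

(** Solutions chosen for the rows of W, that is, on generators, assemble into a
    matrix that solves the congruence for all rows. *)
Lemma choose_rows M n p (W : 'M_(n, gens M)) (F : 'M_(p, gens M)) :
  (forall x, exists y, rels M (x *m W - y *m F)) ->
  exists S, forall x, rels M (x *m W - x *m S *m F).
Proof.
move=> h; have /choice[f hf] : forall i, exists y, rels M (row i W - y *m F).
  by move=> i; have [y hy] := h (delta_mx 0 i); exists y; rewrite rowE.
exists (\matrix_i f i) => x; rewrite -mulmxA -mulmxBr; apply: rels_mulmx => i.
by rewrite linearB /= row_mul rowK.
Qed.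

Definition fpmor_of M N (F : 'M[Q]_(gens M, gens N))
  (hF : forall u, rels M u -> rels N (u *m F)) : fpmor M N := FPMor (asboolT hF).

Lemma comp_fphom_of M N L (phi : fpmor M N) (psi : fpmor N L) :
  @Defs.comp (fpres Q) M N L (fphom_of phi) (fphom_of psi) = fphom_of (fpmor_comp phi psi).
Proof. exact: fphom_comp_of. Qed.

Lemma fphom_of0 M N : fphom_of (0 : fpmor M N) = 0.
Proof. by apply: (addrI (fphom_of 0)); rewrite -fphom_ofD !addr0. Qed.

Lemma fphom_of_eq0 M N (phi : fpmor M N) :
  fphom_of phi = 0 <-> forall x, rels N (x *m fpmor_mx phi).
Proof.
rewrite -fphom_of0 fphom_ofE; split=> h x; have := h x; rewrite /= mulmx0 subr0 //.
Qed.

Lemma comp_eq0P M N L (phi : fpmor M N) (psi : fpmor N L) :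
  @Defs.comp (fpres Q) M N L (fphom_of phi) (fphom_of psi) = 0 <->
  forall x, rels L (x *m fpmor_mx phi *m fpmor_mx psi).
Proof.
rewrite [X in X = _]comp_fphom_of fphom_of_eq0.
by split=> h x; have := h x; rewrite /= mulmxA.
Qed.

Lemma comp_eqP M N L (phi : fpmor M N) (psi : fpmor N L) (chi : fpmor M L) :
  @Defs.comp (fpres Q) M N L (fphom_of phi) (fphom_of psi) = fphom_of chi <->
  forall x, rels L (x *m fpmor_mx phi *m fpmor_mx psi - x *m fpmor_mx chi).
Proof.
rewrite [X in X = _]comp_fphom_of fphom_ofE.
by split=> h x; have := h x; rewrite /= mulmxA.
Qed.

(** The conditions say that kappa is injective modulo relations, with image the
    kernel of phi.  A morphism tau killed by phi is lifted on generators, and the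
    lift respects relations by the last condition. *)
Lemma is_kernelP M N K (phi : fpmor M N) (kappa : fpmor K M) :
  (forall y, rels N (y *m fpmor_mx kappa *m fpmor_mx phi)) ->
  (forall x, rels N (x *m fpmor_mx phi) ->
     exists y, rels M (x - y *m fpmor_mx kappa)) ->
  (forall y, rels M (y *m fpmor_mx kappa) -> rels K y) ->
  @is_kernel (fpres Q) _ _ (fphom_of phi) _ (fphom_of kappa).
Proof.
move=> h0 h1 h2; split.
  exact/comp_eq0P.
move=> L tau; have [t ->] := fphom_of_surj tau.
move=> /comp_eq0P htau.
have [|Z hZ] := choose_rows (M := M) (W := fpmor_mx t) (F := fpmor_mx kappa).
  by move=> x; apply: h1.
have hZL u : rels L u -> rels K (u *m Z).
  move=> hu; apply: h2; apply: rels_congr (rels_congr_sym (hZ u)) _.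
  exact: fpmorP.
exists (fphom_of (fpmor_of hZL)); split.
  by apply/comp_eqP => x /=; apply: rels_congr_sym.
move=> f; have [g ->] := fphom_of_surj f; move=> /comp_eqP hg.
apply/fphom_ofE => x /=; apply: h2; rewrite mulmxBl; apply: rels_congr_sym.
by have := relsD (hg x) (hZ x); rewrite addrA subrK.
Qed.

(** The conditions say that eps is onto modulo relations, with kernel the image of
    phi.  A colift of eta is S eta for a section S of eps on generators, and S eta
    respects relations because eta kills the kernel of eps. *)
Lemma is_cokernelP M N K (phi : fpmor M N) (eps : fpmor N K) :
  (forall x, rels K (x *m fpmor_mx phi *m fpmor_mx eps)) ->
  (forall z, exists y, rels K (z - y *m fpmor_mx eps)) ->
  (forall y, rels K (y *m fpmor_mx eps) -> exists x, rels N (y - x *m fpmor_mx phi)) ->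
  @is_cokernel (fpres Q) _ _ (fphom_of phi) _ (fphom_of eps).
Proof.
move=> h0 h1 h2; split.
  exact/comp_eq0P.
have [|S hS] := choose_rows (M := K) (W := 1%:M) (F := fpmor_mx eps).
  by move=> x; rewrite mulmx1.
move=> L eta; have [e ->] := fphom_of_surj eta.
move=> /comp_eq0P heta.
have he y : rels K (y *m fpmor_mx eps) -> rels L (y *m fpmor_mx e).
  move=> /h2[x hx]; apply: (rels_congr (v := x *m fpmor_mx phi *m fpmor_mx e)).
    by rewrite -mulmxBl; apply: fpmorP.
  exact: heta.
have hSL u : rels K u -> rels L (u *m (S *m fpmor_mx e)).
  move=> hu; rewrite mulmxA; apply: he.
  by apply: rels_congr (rels_congr_sym (hS u)) _; rewrite mulmx1.
exists (fphom_of (fpmor_of hSL)); split.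
  apply/comp_eqP => y /=; rewrite !mulmxA -mulmxBl.
  apply: he; rewrite mulmxBl; apply: rels_congr_sym.
  by have := hS (y *m fpmor_mx eps); rewrite mulmx1.
move=> f; have [g ->] := fphom_of_surj f; move=> /comp_eqP hg.
apply/fphom_ofE => z /=.
have := fpmorP g (hS z); rewrite mulmx1 mulmxBl => hz.
apply: rels_congr_sym; have := relsD hz (hg (z *m S)).
by rewrite addrA subrK mulmxA.
Qed.

Definition free_obj c : fpobj Q := fpobj_of (0 : 'M[Q]_(0, c)).

Lemma rels_free c (u : 'rV_c) : rels (free_obj c) u <-> u = 0.
Proof.
split=> [[y ->]|->]; first by rewrite mulmx0.
by exists 0; rewrite mulmx0.
Qed.

Lemma free_mor_subproof c M (F : 'M[Q]_(c, gens M)) (u : 'rV_c) :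
  rels (free_obj c) u -> rels M (u *m F).
Proof. by move=> /rels_free ->; rewrite mul0mx; apply: rels0. Qed.
Definition free_mor c M (F : 'M[Q]_(c, gens M)) : fpmor (free_obj c) M :=
  @fpmor_of (free_obj c) M F (@free_mor_subproof c M F).

(** A row x is a morphism from the free module of rank one, on which a
    monomorphism can be tested. *)
Lemma mono_rels M N (phi : fpmor M N) :
  @mono (fpres Q) _ _ (fphom_of phi) ->
  forall x, rels N (x *m fpmor_mx phi) -> rels M x.
Proof.
move=> hmono x hx.
have /fphom_ofE/(_ 1%:M) : fphom_of (free_mor x) = fphom_of (free_mor (0 : 'M_(1, gens M))).
  apply: hmono; rewrite [RHS]comp_fphom_of; apply/comp_eqP => y /=.
  rewrite mul0mx mulmx0 subr0 [y]mx11_scalar mul_scalar_mx.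
  by rewrite -scalemxAl -mul_scalar_mx; apply: rels_mulmx => i; rewrite row_id.
by rewrite /= mulmx0 mul1mx subr0.
Qed.

Definition quot_obj r c p (A : 'M[Q]_(r, c)) (F : 'M[Q]_(p, c)) : fpobj Q :=
  fpobj_of (col_mx F A).

Lemma rels_quot r c p (A : 'M[Q]_(r, c)) (F : 'M[Q]_(p, c)) u :
  rels (quot_obj A F) u <-> exists y, rels (fpobj_of A) (u - y *m F).
Proof.
split=> [[y ->]|[y [z hz]]].
  by exists (lsubmx y); exists (rsubmx y); rewrite -{1}[y]hsubmxK mul_row_col addrC addKr.
by exists (row_mx y z); rewrite mul_row_col -hz addrC subrK.
Qed.

Lemma quot_mor_subproof r c p (A : 'M[Q]_(r, c)) (F : 'M[Q]_(p, c)) (u : 'rV_c) :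
  rels (fpobj_of A) u -> rels (quot_obj A F) (u *m 1%:M).
Proof. by move=> hu; apply/rels_quot; exists 0; rewrite mul0mx subr0 mulmx1. Qed.
Definition quot_mor r c p (A : 'M[Q]_(r, c)) (F : 'M[Q]_(p, c)) :
    fpmor (fpobj_of A) (quot_obj A F) :=
  @fpmor_of (fpobj_of A) (quot_obj A F) 1%:M (@quot_mor_subproof r c p A F).

Lemma is_cokernel_quot M r c (A : 'M[Q]_(r, c)) (phi : fpmor M (fpobj_of A)) :
  @is_cokernel (fpres Q) _ _ (fphom_of phi) _ (fphom_of (quot_mor A (fpmor_mx phi))).
Proof.
apply: is_cokernelP => [x|z|y] /=.
- by rewrite mulmx1; apply/rels_quot; exists x; rewrite subrr; apply: rels0.
- by exists z; rewrite mulmx1 subrr; apply: (rels0 (quot_obj _ _)).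
- by rewrite mulmx1 => /rels_quot.
Qed.

(** phi followed by the projection onto its cokernel is 0, so the projection is 0. *)
Lemma epi_rels M r c (A : 'M[Q]_(r, c)) (phi : fpmor M (fpobj_of A)) :
  @epi (fpres Q) _ _ (fphom_of phi) ->
  forall z, exists y, rels (fpobj_of A) (z - y *m fpmor_mx phi).
Proof.
move=> hepi z; have [h0 _] := is_cokernel_quot phi.
have /fphom_of_eq0/(_ z) : fphom_of (quot_mor A (fpmor_mx phi)) = 0.
  by apply: hepi; rewrite h0 compm0.
by rewrite /= mulmx1 => /rels_quot.
Qed.

Lemma surj_epi M N (phi : fpmor M N) :
  (forall z : 'rV_(gens N), exists y, rels N (z - y *m fpmor_mx phi)) ->
  @epi (fpres Q) _ _ (fphom_of phi).
Proof.
move=> hs L f g; have [a ->] := fphom_of_surj f; have [b ->] := fphom_of_surj g.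
rewrite [RHS]comp_fphom_of => /comp_eqP h; apply/fphom_ofE => z.
have [y hy] := hs z; have := fpmorP a hy; have := fpmorP b hy.
rewrite !mulmxBl => hb ha; have := relsB (relsD ha (h y)) hb.
by rewrite /= mulmxA addrA subrK opprB addrA subrK.
Qed.

(** A row x with x U in the span of V is the first part of a syzygy (x, - w). *)
Lemma lsubmx_syzygies m n e k (U : 'M[Q]_(m, n)) (V : 'M[Q]_(k, n)) (Z : 'M[Q]_(e, m + k)) x :
  is_left_syzygies (col_mx U V) Z ->
  rels (fpobj_of V) (x *m U) <-> exists y, x = y *m lsubmx Z.
Proof.
move=> hZ; split=> [[w hw]|[y ->]].
  have /hZ[y hy] : row_mx x (- w) *m col_mx U V = 0.
    by rewrite mul_row_col hw mulNmx subrr.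
  exists y; have := congr1 lsubmx hy; rewrite row_mxKl => ->.
  by rewrite -{1}[Z]hsubmxK mul_mx_row row_mxKl.
have /hZ : exists w, y *m Z = w *m Z by exists y.
rewrite -{1}[Z]hsubmxK mul_mx_row mul_row_col => /eqP; rewrite addr_eq0 => /eqP ->.
by exists (- (y *m rsubmx Z)); rewrite mulNmx.
Qed.

Section KernelPresentation.
Variables (r c p q d l : nat) (A : 'M[Q]_(r, c)) (B : 'M[Q]_(d, p)).
Variables (phi : fpmor (fpobj_of A) (fpobj_of B)).
Variables (X : 'M[Q]_(q, c + d)) (Y : 'M[Q]_(l, q + r)).
Hypothesis (hX : is_left_syzygies (col_mx (fpmor_mx phi) B) X).
Hypothesis (hY : is_left_syzygies (col_mx (lsubmx X) A) Y).

Definition ker_obj : fpobj Q := fpobj_of (lsubmx Y).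

Lemma rels_ker (y : 'rV_q) : rels ker_obj y <-> rels (fpobj_of A) (y *m lsubmx X).
Proof. exact: iff_sym (lsubmx_syzygies y hY). Qed.

Definition ker_mor : fpmor ker_obj (fpobj_of A) :=
  @fpmor_of ker_obj (fpobj_of A) (lsubmx X) (fun y => (rels_ker y).1).

Lemma is_kernel_ker : @is_kernel (fpres Q) _ _ (fphom_of phi) _ (fphom_of ker_mor).
Proof.
apply: is_kernelP => [y|x|y] /=.
- by apply/(lsubmx_syzygies _ hX); exists y.
- by move=> /(lsubmx_syzygies _ hX)[y ->]; exists y; rewrite subrr; apply: (rels0 (fpobj_of A)).
- by move/rels_ker.
Qed.
End KernelPresentation.

(** The rows that vanish modulo the rows of phi are those congruent to a multiple
    of phi; injectivity is [mono_rels]. *)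
Lemma mono_is_kernel M r c (A : 'M[Q]_(r, c)) (phi : fpmor M (fpobj_of A)) :
  @mono (fpres Q) _ _ (fphom_of phi) ->
  @is_kernel (fpres Q) _ _ (fphom_of (quot_mor A (fpmor_mx phi))) _ (fphom_of phi).
Proof.
move=> hmono; apply: is_kernelP => [y|x|y]; rewrite ?mulmx1.
- by apply/rels_quot; exists y; rewrite subrr; apply: (rels0 (fpobj_of A)).
- by move/rels_quot.
- exact: (mono_rels hmono).
Qed.

(** The rows that phi kills are multiples of the embedding of the kernel, by the
    choice of X, and phi is onto by [epi_rels]. *)
Lemma epi_is_cokernel r c p d q l (A : 'M[Q]_(r, c)) (B : 'M[Q]_(d, p))
    (phi : fpmor (fpobj_of A) (fpobj_of B))
    (X : 'M[Q]_(q, c + d)) (Y : 'M[Q]_(l, q + r))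
    (hX : is_left_syzygies (col_mx (fpmor_mx phi) B) X)
    (hY : is_left_syzygies (col_mx (lsubmx X) A) Y) :
  @epi (fpres Q) _ _ (fphom_of phi) ->
  @is_cokernel (fpres Q) _ _ (fphom_of (ker_mor hY)) _ (fphom_of phi).
Proof.
move=> hepi; apply: is_cokernelP => [x|z|y] /=.
- by apply/(lsubmx_syzygies _ hX); exists x.
- exact: (epi_rels hepi).
- move=> /(lsubmx_syzygies _ hX)[x ->]; exists x.
  by rewrite subrr; apply: (rels0 (fpobj_of A)).
Qed.

Lemma zero_obj_free : is_zero_obj (free_obj 0 : fpres Q).
Proof.
split=> M; exists 0; split=> // f _; have [phi ->] := fphom_of_surj f.
  apply/esym/fphom_of_eq0 => x; rewrite thinmx0; exact: rels0.
apply/esym/fphom_of_eq0 => x; rewrite (thinmx0 x) mul0mx; exact: rels0.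
Qed.

Section DirectSum.
Variables (a m b n : nat) (A : 'M[Q]_(a, m)) (B : 'M[Q]_(b, n)).
Local Notation M := (fpobj_of A).
Local Notation N := (fpobj_of B).
Definition sum_obj : fpobj Q := fpobj_of (block_mx A 0 0 B).

Lemma rels_sum (u : 'rV_(m + n)) :
  rels sum_obj u <-> rels M (lsubmx u) /\ rels N (rsubmx u).
Proof.
split=> [[y ->]|[[y hy] [z hz]]].
  rewrite -[y]hsubmxK mul_row_block !mulmx0 addr0 add0r row_mxKl row_mxKr.
  by split; eexists.
exists (row_mx y z); rewrite mul_row_block !mulmx0 addr0 add0r -hy -hz.
by rewrite hsubmxK.
Qed.

Lemma rels_sum_row (u : 'rV_m) (v : 'rV_n) :
  rels sum_obj (row_mx u v) <-> rels M u /\ rels N v.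
Proof. by rewrite rels_sum row_mxKl row_mxKr. Qed.

Lemma sum_inl_subproof (u : 'rV_m) : rels M u -> rels sum_obj (u *m row_mx 1%:M 0).
Proof.
move=> hu; rewrite mul_mx_row mulmx1 mulmx0; apply/rels_sum_row.
by split=> //; apply: (rels0 N).
Qed.
Definition sum_inl : fpmor M sum_obj := @fpmor_of M sum_obj _ sum_inl_subproof.

Lemma sum_inr_subproof (u : 'rV_n) : rels N u -> rels sum_obj (u *m row_mx 0 1%:M).
Proof.
move=> hu; rewrite mul_mx_row mulmx1 mulmx0; apply/rels_sum_row.
by split=> //; apply: (rels0 M).
Qed.
Definition sum_inr : fpmor N sum_obj := @fpmor_of N sum_obj _ sum_inr_subproof.

Lemma sum_copair_subproof L (F : 'M[Q]_(m, gens L)) (G : 'M[Q]_(n, gens L)) :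
  (forall u, rels M u -> rels L (u *m F)) -> (forall u, rels N u -> rels L (u *m G)) ->
  forall u : 'rV_(m + n), rels sum_obj u -> rels L (u *m col_mx F G).
Proof.
move=> hF hG u /rels_sum[hl hr]; rewrite -[u]hsubmxK mul_row_col.
by apply: relsD; [apply: hF | apply: hG].
Qed.
Definition sum_copair L (phi : fpmor M L) (psi : fpmor N L) : fpmor sum_obj L :=
  @fpmor_of sum_obj L _ (sum_copair_subproof (fpmorP phi) (fpmorP psi)).

Lemma sum_prl_subproof (u : 'rV_(m + n)) :
  rels sum_obj u -> rels M (u *m col_mx 1%:M 0).
Proof.
by move=> /rels_sum[hl hr]; rewrite -[u]hsubmxK mul_row_col mulmx1 mulmx0 addr0.
Qed.
Definition sum_prl : fpmor sum_obj M := @fpmor_of sum_obj M _ sum_prl_subproof.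

Lemma sum_prr_subproof (u : 'rV_(m + n)) :
  rels sum_obj u -> rels N (u *m col_mx 0 1%:M).
Proof.
by move=> /rels_sum[hl hr]; rewrite -[u]hsubmxK mul_row_col mulmx1 mulmx0 add0r.
Qed.
Definition sum_prr : fpmor sum_obj N := @fpmor_of sum_obj N _ sum_prr_subproof.

Lemma sum_pairing_subproof L (phi : fpmor L M) (psi : fpmor L N) u :
  rels L u -> rels sum_obj (u *m row_mx (fpmor_mx phi) (fpmor_mx psi)).
Proof.
move=> hu; rewrite mul_mx_row; apply/rels_sum_row.
by split; apply: fpmorP.
Qed.
Definition sum_pairing L (phi : fpmor L M) (psi : fpmor L N) : fpmor L sum_obj :=
  @fpmor_of L sum_obj _ (sum_pairing_subproof phi psi).

Lemma sum_inl_copair L (phi : fpmor M L) (psi : fpmor N L) :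
  @Defs.comp (fpres Q) _ _ _ (fphom_of sum_inl) (fphom_of (sum_copair phi psi))
  = fphom_of phi.
Proof.
apply/comp_eqP => x /=.
by rewrite -mulmxA mul_row_col mul1mx mul0mx addr0 subrr; apply: rels0.
Qed.

Lemma sum_inr_copair L (phi : fpmor M L) (psi : fpmor N L) :
  @Defs.comp (fpres Q) _ _ _ (fphom_of sum_inr) (fphom_of (sum_copair phi psi))
  = fphom_of psi.
Proof.
apply/comp_eqP => x /=.
by rewrite -mulmxA mul_row_col mul1mx mul0mx add0r subrr; apply: rels0.
Qed.

Lemma sum_pairing_prl L (phi : fpmor L M) (psi : fpmor L N) :
  @Defs.comp (fpres Q) _ _ _ (fphom_of (sum_pairing phi psi)) (fphom_of sum_prl)
  = fphom_of phi.
Proof.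
apply/comp_eqP => x /=.
by rewrite -mulmxA mul_row_col mulmx1 mulmx0 addr0 subrr; apply: (rels0 M).
Qed.

Lemma sum_pairing_prr L (phi : fpmor L M) (psi : fpmor L N) :
  @Defs.comp (fpres Q) _ _ _ (fphom_of (sum_pairing phi psi)) (fphom_of sum_prr)
  = fphom_of psi.
Proof.
apply/comp_eqP => x /=.
by rewrite -mulmxA mul_row_col mulmx1 mulmx0 add0r subrr; apply: (rels0 N).
Qed.

Lemma is_direct_sum_sum :
  @is_direct_sum (fpres Q) M N sum_obj (fphom_of sum_inl) (fphom_of sum_inr)
    (fphom_of sum_prl) (fphom_of sum_prr).
Proof.
split; first split.
- apply/comp_eqP => x /=; rewrite -mulmxA mul_row_col mulmx1 mulmx0 addr0 subrr.
  exact: (rels0 M).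
- apply/comp_eqP => x /=; rewrite -mulmxA mul_row_col mulmx1 mulmx0 add0r subrr.
  exact: (rels0 N).
- apply/comp_eq0P => x /=; rewrite -mulmxA mul_row_col mulmx0 mul0mx addr0 mulmx0.
  exact: (rels0 N).
- apply/comp_eq0P => x /=; rewrite -mulmxA mul_row_col mulmx0 mul0mx addr0 mulmx0.
  exact: (rels0 M).
- move=> L f g; have [phi ->] := fphom_of_surj f; have [psi ->] := fphom_of_surj g.
  exists (fphom_of (sum_copair phi psi)).
  split; first by split; [apply: sum_inl_copair | apply: sum_inr_copair].
  move=> h; have [chi ->] := fphom_of_surj h => -[/comp_eqP h1 /comp_eqP h2].
  apply/fphom_ofE => x /=; apply: rels_congr_sym.
  have := relsD (h1 (lsubmx x)) (h2 (rsubmx x)) => /=.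
  rewrite addrACA -mulmxDl -opprD !mul_mx_row !mulmx1 !mulmx0 add_row_mx addr0 add0r.
  by rewrite hsubmxK -mul_row_col hsubmxK.
- move=> L f g; have [phi ->] := fphom_of_surj f; have [psi ->] := fphom_of_surj g.
  exists (fphom_of (sum_pairing phi psi)).
  split; first by split; [apply: sum_pairing_prl | apply: sum_pairing_prr].
  move=> h; have [chi ->] := fphom_of_surj h => -[/comp_eqP h1 /comp_eqP h2].
  apply/fphom_ofE => x; apply: rels_congr_sym; apply/rels_sum.
  rewrite mul_mx_row !linearB /= row_mxKl row_mxKr.
  have := h1 x; have := h2 x; rewrite /= -[x *m fpmor_mx chi]hsubmxK.
  by rewrite !mul_row_col !mulmx1 !mulmx0 addr0 add0r row_mxKl row_mxKr.
Qed.

End DirectSum.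

Definition coherent := forall r c (A : 'M[Q]_(r, c)),
  exists q (X : 'M[Q]_(q, r)), is_left_syzygies A X.

Theorem fpres_abelian : coherent -> abelian (fpres Q).
Proof.
move=> coh.
have obj_mx (M : fpres Q) : exists r c (A : 'M[Q]_(r, c)), M = fpobj_of A.
  exact: fpobj_of_surj.
split.
- by exists (free_obj 0); apply: zero_obj_free.
- move=> M N; have [a [m [A ->]]] := obj_mx M; have [b [n [B ->]]] := obj_mx N.
  by do 5!eexists; apply: is_direct_sum_sum.
- move=> M N; have [a [m [A ->]]] := obj_mx M; have [b [n [B ->]]] := obj_mx N.
  move=> f; have [phi ->] := fphom_of_surj f.
  split; last by do 2!eexists; apply: is_cokernel_quot.
  have [q [X hX]] := coh _ _ (col_mx (fpmor_mx phi) B).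
  have [l [Y hY]] := coh _ _ (col_mx (lsubmx X) A).
  by do 2!eexists; apply: is_kernel_ker hX hY.
- move=> M N; have [b [n [B ->]]] := obj_mx N.
  move=> f; have [phi ->] := fphom_of_surj f => /mono_is_kernel h.
  by do 2!eexists; apply: h.
- move=> M N; have [a [m [A ->]]] := obj_mx M; have [b [n [B ->]]] := obj_mx N.
  move=> f; have [phi ->] := fphom_of_surj f.
  have [q [X hX]] := coh _ _ (col_mx (fpmor_mx phi) B).
  have [l [Y hY]] := coh _ _ (col_mx (lsubmx X) A).
  by move=> /(epi_is_cokernel hX hY) h; do 2!eexists; apply: h.
Qed.

(** phi factors through its image, which lies in the image of eps, that is, in the
    kernel of the cokernel of eps; so phi vanishes modulo the rows of eps. *)
Lemma im_le_rels P M r c (A : 'M[Q]_(r, c)) (phi : fpmor P (fpobj_of A))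
    (eps : fpmor M (fpobj_of A)) :
  @im_le (fpres Q) _ _ _ (fphom_of phi) (fphom_of eps) ->
  forall x, exists y, rels (fpobj_of A) (x *m fpmor_mx phi - y *m fpmor_mx eps).
Proof.
move=> [I [i [J [j [[K [c1 [hc1 hi]]] [K' [c2 [hc2 hj]]] [f hf]]]]]] x.
have [e [he _]] := hi.2 _ _ hc1.1.
have [g [hg _]] := hc2.2 _ _ (is_cokernel_quot eps).1.
suff /comp_eq0P/(_ x) : Defs.comp (p := fpres Q) (fphom_of phi)
    (fphom_of (quot_mor A (fpmor_mx eps))) = 0.
  by rewrite /= mulmx1 => /rels_quot.
by rewrite -hg -he -hf -!Defs.compA (Defs.compA j) hj.1 comp0m !compm0.
Qed.

(** A morphism that is onto has the whole target as image, as the zero object is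
    its cokernel. *)
Lemma surj_im_le P M N (phi : fpmor P N) (eps : fpmor M N) :
  (forall z : 'rV_(gens N), exists y, rels N (z - y *m fpmor_mx phi)) ->
  (forall z : 'rV_(gens N), exists y, rels N (z - y *m fpmor_mx eps)) ->
  @im_le (fpres Q) _ _ _ (fphom_of phi) (fphom_of eps).
Proof.
have im (M' : fpobj Q) (f : fpmor M' N) :
  (forall z : 'rV_(gens N), exists y, rels N (z - y *m fpmor_mx f)) ->
  @is_image (fpres Q) _ _ (fphom_of f) N (idm (N : fpres Q)).
  move=> hf; exists (free_obj 0), 0; split; split; rewrite ?compm0 //.
  - move=> L eta h; exists 0; split.
      by rewrite [LHS]comp0m; apply: (surj_epi hf); rewrite h compm0.
    move=> g _; have [_ /(_ L)[g0 [_ uniq]]] := zero_obj_free.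
    by rewrite -(uniq 0 I) -(uniq g I).
  - move=> L tau _; exists tau; split; first exact: compm1.
    by move=> g; rewrite compm1.
move=> hphi heps; exists N, (idm (N : fpres Q)), N, (idm (N : fpres Q)).
split; [exact: im | exact: im |].
by exists (idm (N : fpres Q)); rewrite compm1.
Qed.

Lemma free_projective c : @projective (fpres Q) (free_obj c).
Proof.
move=> M N; have [r [d [A ->]]] : exists r c (A : 'M[Q]_(r, c)), N = fpobj_of A.
  exact: fpobj_of_surj.
move=> f g; have [phi ->] := fphom_of_surj f; have [eps ->] := fphom_of_surj g.
move=> /im_le_rels/choose_rows[S hS].
exists (fphom_of (free_mor S)); apply/comp_eqP => x.
exact/(@rels_congr_sym (fpobj_of A))/hS.
Qed.

Definition free_cover r c (A : 'M[Q]_(r, c)) : fpmor (free_obj c) (fpobj_of A) :=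
  @free_mor c (fpobj_of A) 1%:M.

Lemma free_cover_surj r c (A : 'M[Q]_(r, c)) (z : 'rV_c) :
  exists y, rels (fpobj_of A) (z - y *m fpmor_mx (free_cover A)).
Proof. by exists z; rewrite mulmx1 subrr; apply: rels0. Qed.

(** Lifting the identity along the free cover gives sigma with sigma = 1 modulo the
    relations, so 1 - sigma = Y P, and with P sigma = 0, as the cover has no
    relations; hence P = P (1 - sigma) = P Y P. *)
Lemma projective_regular r c (P : 'M[Q]_(r, c)) :
  @projective (fpres Q) (fpobj_of P) -> exists Y, P *m Y *m P = P.
Proof.
move=> /(_ _ _ (fphom_of (fpmor_id (fpobj_of P))) (fphom_of (free_cover P)))[].
  apply: surj_im_le => z; last exact: free_cover_surj.
  by exists z; rewrite mulmx1 subrr; apply: (rels0 (fpobj_of P)).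
move=> f; have [sigma ->] := fphom_of_surj f => /comp_eqP h.
have [|Y hY] := @mulmx_factor c c r (1%:M - fpmor_mx sigma) P.
  move=> x; have [y hy] := rels_congr_sym (h x).
  by exists y; rewrite -hy mulmxBr !mulmx1.
exists Y; rewrite -mulmxA -hY mulmxBr mulmx1; apply/row_matrixP => i.
rewrite linearB /= [row i (_ *m _)]row_mul.
have : rels (fpobj_of P) (row i P) by exists (delta_mx 0 i); rewrite rowE.
by move=> /(fpmorP sigma)/rels_free ->; rewrite subr0.
Qed.

(** 1 - Y P sends the relations of P to 0 and is the identity modulo them, so it
    makes a morphism out of any matrix F, well defined on generators only. *)
Lemma regular_lift_subproof r c (P : 'M[Q]_(r, c)) Y M (F : 'M[Q]_(c, gens M)) :
  P *m Y *m P = P -> forall u : 'rV_c,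
  rels (fpobj_of P) u -> rels M (u *m ((1%:M - Y *m P) *m F)).
Proof.
move=> hY u [y ->]; rewrite !mulmxA mulmxBr mulmx1 !mulmxA.
by rewrite -[y *m P *m Y]mulmxA -(mulmxA y) hY subrr mul0mx; apply: rels0.
Qed.
Definition regular_lift r c (P : 'M[Q]_(r, c)) Y M (F : 'M[Q]_(c, gens M))
  (hY : P *m Y *m P = P) : fpmor (fpobj_of P) M :=
  @fpmor_of (fpobj_of P) M _ (@regular_lift_subproof _ _ P Y M F hY).

Lemma regular_liftP r c (P : 'M[Q]_(r, c)) Y M N (F : 'M[Q]_(c, gens M))
    (phi : fpmor (fpobj_of P) N) (eps : fpmor M N) (hY : P *m Y *m P = P) :
  (forall x, rels N (x *m fpmor_mx phi - x *m F *m fpmor_mx eps)) ->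
  @Defs.comp (fpres Q) _ _ _ (fphom_of (regular_lift F hY)) (fphom_of eps) = fphom_of phi.
Proof.
move=> hF; apply/comp_eqP => x /=; rewrite !mulmxA.
set z := x *m (1%:M - Y *m P); apply: rels_congr_sym.
(* x = z + x Y P, where x Y P is a relation of P, and F lifts z phi along eps *)
have -> : x *m fpmor_mx phi - z *m F *m fpmor_mx eps =
    (z *m fpmor_mx phi - z *m F *m fpmor_mx eps) + x *m Y *m P *m fpmor_mx phi.
  rewrite addrAC; congr (_ - _); rewrite -mulmxDl; congr (_ *m _).
  by rewrite /z mulmxBr mulmx1 mulmxA subrK.
by apply: relsD (hF z) _; apply: (fpmorP phi); exists (x *m Y).
Qed.

End FinitePresentations.

(** * Linear systems over a localization *)

Definition effective_syzygies (Q : pzRingType) (rep : tree -> Q -> Prop) syz :=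
  forall r1 r0 (A : 'M[Q]_(r1, r0)) t, mx_code rep t A ->
  computes syz t (fun d =>
    exists r2 (X : 'M[Q]_(r2, r1)), mx_code rep d X /\ is_left_syzygies A X).

(** Solvability is a promise: in each use, a kernel or a projective object provides
    a solution beforehand. *)
Definition effective_solutions (Q : pzRingType) (rep : tree -> Q -> Prop) sol :=
  forall r2 r1 r0 (A : 'M[Q]_(r1, r0)) (B : 'M[Q]_(r2, r0)) t u,
  mx_code rep t A -> mx_code rep u B -> (exists X, X *m A = B) ->
  computes sol (list_tree [:: t; u])
    (fun d => exists2 X, mx_code rep d X & X *m A = B).

Section Localization.
Local Open Scope quotient_scope.
Variables (R : comPzRingType) (S : {pred R}) (hS : mulr_closed S).
Local Notation L := (localization hS).
Local Notation ratio := (Localization.ratio S).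
Local Notation num x := (Localization.numden x).1.
Local Notation den x := (Localization.numden x).2.

Definition frac (a s : R) (sS : s \in S) : L := \pi_L (Localization.Ratio (numden := (a, s)) sS).
Definition loc (a : R) : L := frac a (Localization.S1 hS).

Lemma loc_is_zmod_morphism : zmod_morphism loc.
Proof.
move=> a b; apply/esym; rewrite /loc /frac.
rewrite [X in _ + X](Localization.pi_opp hS) [LHS](Localization.pi_add hS).
by apply: Localization.ratio_eq1 => /=; ring.
Qed.

Lemma loc_is_monoid_morphism : monoid_morphism loc.
Proof.
split=> [//|a b]; apply/esym; rewrite [LHS](Localization.pi_mul hS).
by apply: Localization.ratio_eq1 => /=; ring.
Qed.

HB.instance Definition _ := GRing.isZmodMorphism.Build R L loc loc_is_zmod_morphism.
HB.instance Definition _ := GRing.isMonoidMorphism.Build R L loc loc_is_monoid_morphism.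

Lemma frac_mul_loc a s (sS : s \in S) : frac a sS * loc s = loc a.
Proof.
rewrite [LHS](Localization.pi_mul hS).
by apply: Localization.ratio_eq1 => /=; ring.
Qed.

Lemma pi_mul_loc (x : ratio) : \pi_L x * loc (den x) = loc (num x).
Proof.
rewrite [LHS](Localization.pi_mul hS).
by apply: Localization.ratio_eq1 => /=; ring.
Qed.

Lemma loc_unit s : s \in S -> exists v, loc s * v = 1.
Proof.
by move=> sS; exists (frac 1 sS); rewrite mulrC frac_mul_loc rmorph1.
Qed.

Lemma mul_loc_inj s : s \in S -> injective (fun q : L => q * loc s).
Proof.
by move=> /loc_unit[v hv] p q /(congr1 (fun x => x * v)); rewrite -!mulrA hv !mulr1.
Qed.

Lemma loc_eq0 a : loc a = 0 -> exists2 s, s \in S & s * a = 0.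
Proof.
move=> /eqmodP/asboolP[s sS]; rewrite /= => h; exists s => //.
by move: h; rewrite mulr1 mul0r mulr0.
Qed.

Lemma prod_closed (I : finType) (P : pred I) (F : I -> R) :
  (forall i, F i \in S) -> \prod_(i | P i) F i \in S.
Proof.
move=> hF; apply: (big_ind (fun x => x \in S)) => [|x y|i _]; last exact: hF.
  exact: Localization.S1 hS.
exact: (Localization.SM hS).
Qed.

Lemma common_denominator n (x : 'rV[L]_n) :
  exists s (a : 'rV[R]_n), s \in S /\ loc s *: x = map_mx loc a.
Proof.
have /choice[y hy] : forall i, exists y : ratio, x 0 i = \pi_L y.
  by move=> i; exists (repr (x 0 i)); rewrite reprK.
exists (\prod_i den (y i)), (\row_j (num (y j) * \prod_(i | i != j) den (y i))).
split; first by apply: prod_closed => i; apply: Localization.denP.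
apply/rowP => j; rewrite !mxE hy (bigD1 j) //= !rmorphM /= -pi_mul_loc.
by rewrite mulrC mulrA.
Qed.

Lemma row_annihilator n (a : 'rV[R]_n) : map_mx loc a = 0 -> exists2 s, s \in S & s *: a = 0.
Proof.
move=> ha; have /choice[s hs] : forall i, exists s, s \in S /\ s * a 0 i = 0.
  move=> i; have [|s sS hs] := @loc_eq0 (a 0 i); last by exists s.
  by have /rowP/(_ i) := ha; rewrite !mxE.
exists (\prod_i s i); first by apply: prod_closed => i; case: (hs i).
apply/rowP => j; rewrite !mxE (bigD1 j) //= mulrAC.
by case: (hs j) => _ ->; rewrite mul0r.
Qed.

Lemma loc_dependence n c (A : 'M[R]_(n, c)) (x : 'rV[L]_n) :
  x *m map_mx loc A = 0 ->
  exists s (y : 'rV[R]_n), [/\ s \in S, loc s *: x = map_mx loc y & y *m A = 0].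
Proof.
move=> hx; have [d [a [dS ha]]] := common_denominator x.
have [|t tS ht] := @row_annihilator _ (a *m A).
  by rewrite map_mxM -ha -scalemxAl hx scaler0.
exists (t * d), (t *: a); split; first exact: (Localization.SM hS).
  by rewrite rmorphM -scalerA ha map_mxZ.
by rewrite -scalemxAl.
Qed.

(** Flatness of the localization, in terms of generators of the kernel. *)
Lemma loc_syzygies r c q (A : 'M[R]_(r, c)) (X : 'M[R]_(q, r)) :
  is_left_syzygies A X -> is_left_syzygies (map_mx loc A) (map_mx loc X).
Proof.
move=> hX x; split=> [/loc_dependence[s [y [sS hy /hX[z hz]]]]|[y ->]].
  have [v hv] := loc_unit sS.
  exists (v *: map_mx loc z); rewrite -scalemxAl -map_mxM -hz -hy scalerA.
  by rewrite mulrC hv scale1r.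
rewrite -mulmxA -map_mxM (_ : X *m A = 0) ?map_mx0 ?mulmx0 //.
by apply/row_matrixP => i; rewrite row_mul row0; apply/hX; exists (delta_mx 0 i); rewrite rowE.
Qed.

Lemma loc_solvable n c (A : 'M[R]_(n, c)) (b : 'rV[R]_c) (x : 'rV[L]_n) :
  x *m map_mx loc A = map_mx loc b ->
  exists2 s, s \in S & exists y : 'rV[R]_n, s *: b = y *m A.
Proof.
move=> hx; have [d [a [dS ha]]] := common_denominator x.
have [|t tS] := @row_annihilator _ (a *m A - d *: b).
  by rewrite map_mxB map_mxM -ha -scalemxAl hx map_mxZ subrr.
rewrite scalerBr scalerA => /subr0_eq h.
exists (t * d); first exact: (Localization.SM hS).
by exists (t *: a); rewrite -scalemxAl.
Qed.

(** Column j is multiplied by the product of its denominators; in entry (i, j) the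
    denominator with index i cancels and is replaced by the numerator. *)
Definition clear_cols r c (X : 'M[ratio]_(r, c)) : 'M[R]_(r, c) :=
  \matrix_(i, j) \prod_(k < r) (if k == i then num (X k j) else den (X k j)).

(** Scaling the columns is an invertible operation on the right, and so keeps left
    kernels and solutions of X A = B, also when A and B are scaled together. *)
Lemma clear_colsE r c (X : 'M[ratio]_(r, c)) : exists D D' : 'M[L]_c,
  D *m D' = 1%:M /\ map_mx loc (clear_cols X) = map_mx (\pi_L) X *m D.
Proof.
pose d j := \prod_k den (X k j).
have /choice[v hv] : forall j, exists v, loc (d j) * v = 1.
  by move=> j; apply: loc_unit; apply: prod_closed => k; apply: Localization.denP.
exists (diag_mx (\row_j loc (d j))), (diag_mx (\row_j v j)); split.
  by rewrite mulmx_diag -diag_const_mx; congr diag_mx; apply/rowP => j; rewrite !mxE.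
rewrite mul_mx_diag; apply/matrixP => i j; rewrite !mxE /d.
rewrite [in LHS](bigD1 i) //= [in RHS](bigD1 i) //= eqxx !rmorphM /= mulrA pi_mul_loc.
congr (_ * loc _).
by apply: eq_bigr => k /negPf ->.
Qed.

Section Programs.
Variables (rep : tree -> R -> Prop) (ar : ring_progs).
Hypothesis arP : ring_progs_spec rep ar.
Local Notation lrep := (@Localization.code R S hS rep).

(** Numerators and denominators are handled by programs, which see a fraction and
    not its class; the class of a matrix of fractions is recovered at the end. *)
Definition ratio_code (t : tree) (x : ratio) := exists u v,
  [/\ rep u (num x), rep v (den x) & t = list_tree [:: u; v]].

Lemma ratio_code_mx r c (A : 'M[L]_(r, c)) t : mx_code lrep t A ->
  exists2 X : 'M[ratio]_(r, c), mx_code ratio_code t X & A = map_mx (\pi_L) X.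
Proof.
move=> [E hE ->]; have /choice[f hf] : forall ij : 'I_r * 'I_c, exists x : ratio,
    ratio_code (E ij.1 ij.2) x /\ A ij.1 ij.2 = \pi_L x.
  by move=> [i j]; have [x [u [v [hu hv et eA]]]] := hE i j; exists x; split=> //; exists u, v.
exists (\matrix_(i, j) f (i, j)).
  by exists E => // i j; rewrite mxE; apply: (hf (i, j)).1.
by apply/matrixP => i j; rewrite !mxE; apply: (hf (i, j)).2.
Qed.

Lemma loc_codeI a s (sS : s \in S) u v :
  rep u a -> rep v s -> lrep (list_tree [:: u; v]) (frac a sS).
Proof. by move=> hu hv; exists (Localization.Ratio (numden := (a, s)) sS), u, v. Qed.

Definition PNum p := PSeq p PHd.
Definition PDen p := PSeq p (PVar 1).

Definition loc_ring_progs : ring_progs := RingProgs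
  (list_tree [:: zero_t ar; one_t ar]) (list_tree [:: one_t ar; one_t ar])
  (PList [:: PCall (add_p ar)
               [:: PCall (mul_p ar) [:: PNum (PVar 0); PDen (PVar 1)];
                   PCall (mul_p ar) [:: PNum (PVar 1); PDen (PVar 0)]];
             PCall (mul_p ar) [:: PDen (PVar 0); PDen (PVar 1)]])
  (PList [:: PSeq (PNum PId) (opp_p ar); PDen PId])
  (PList [:: PCall (mul_p ar) [:: PNum (PVar 0); PNum (PVar 1)];
             PCall (mul_p ar) [:: PDen (PVar 0); PDen (PVar 1)]]).

Lemma loc_ring_progsP : ring_progs_spec lrep loc_ring_progs.
Proof.
have [h0 h1 hadd hopp hmul] := arP; split.
- by exists (Localization.ratio0 hS), (zero_t ar), (one_t ar).
- by exists (Localization.ratio1 hS), (one_t ar), (one_t ar).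
- move=> _ _ _ _ [x [u [v [hu hv -> ->]]]] [y [u' [v' [hu' hv' -> ->]]]].
  rewrite /loc_ring_progs /PNum /PDen /=; wp_base => /=.
  apply: computes_weaken (hmul _ _ _ _ hu hv') _ => a ha; wp_base => /=.
  apply: computes_weaken (hmul _ _ _ _ hu' hv) _ => b hb; wp_base => /=.
  apply: computes_weaken (hadd _ _ _ _ ha hb) _ => n hn; wp_base => /=.
  apply: computes_weaken (hmul _ _ _ _ hv hv') _ => d hd; wp_base => /=.
  exists (Localization.addr hS x y), n, d; split=> //.
  exact: Localization.pi_add.
- move=> _ _ [x [u [v [hu hv -> ->]]]].
  rewrite /loc_ring_progs /PNum /PDen /=; wp_base => /=.
  apply: computes_weaken (hopp _ _ hu) _ => n hn; wp_base => /=.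
  exists (Localization.oppr x), n, v; split=> //.
  exact: Localization.pi_opp.
- move=> _ _ _ _ [x [u [v [hu hv -> ->]]]] [y [u' [v' [hu' hv' -> ->]]]].
  rewrite /loc_ring_progs /PNum /PDen /=; wp_base => /=.
  apply: computes_weaken (hmul _ _ _ _ hu hu') _ => n hn; wp_base => /=.
  apply: computes_weaken (hmul _ _ _ _ hv hv') _ => d hd; wp_base => /=.
  exists (Localization.mulr hS x y), n, d; split=> //.
  exact: Localization.pi_mul.
Qed.

Definition PClear := PMx (PRows (PVar 0)) (PCols (PVar 0))
  (PFor (PRows (PVar 2)) (PConst (one_t ar)) (PCall (mul_p ar)
    [:: PIfEq (PVar 0) (PVar 3)
          (PNum (PEntry (PVar 4) (PVar 0) (PVar 2)))
          (PDen (PEntry (PVar 4) (PVar 0) (PVar 2)));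
        PVar 1])).

Lemma computes_clear r c (X : 'M[ratio]_(r, c)) t : mx_code ratio_code t X ->
  computes PClear (list_tree [:: t]) (fun d => mx_code rep d (clear_cols X)).
Proof.
move=> hX; rewrite /PClear; wp => i j.
apply: (@computes_big _ rep 1 *%R r
  (fun k : 'I_r => if k == i then num (X k j) else den (X k j))).
- exact: one_tP arP.
- by move=> *; apply: (mul_pP arP).
- by wp.
- move=> k acc; rewrite /PNum /PDen; wp; rewrite -val_eqE /=.
  by case: eqP => _; wp => _ [u [v [hu hv ->]]]; wp.
- by move=> d; rewrite mxE.
Qed.

Definition PLocMx := PMx (PRows PId) (PCols PId)
  (PList [:: PEntry (PSeq PTl PTl) (PVar 1) (PVar 0); PConst (one_t ar)]).

Lemma computes_loc_mx r c (A : 'M[R]_(r, c)) t : mx_code rep t A ->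
  computes PLocMx t (fun d => mx_code lrep d (map_mx loc A)).
Proof.
move=> hA; rewrite /PLocMx; wp => i j; wp => u hu; wp.
by rewrite mxE; apply: loc_codeI hu (one_tP arP).
Qed.

Definition PSyzLoc syz := PSeq (PCall PClear [:: PId]) (PSeq syz PLocMx).

Lemma loc_effective_syzygies syz :
  effective_syzygies rep syz -> effective_syzygies lrep (PSyzLoc syz).
Proof.
move=> hsyz r c A t /ratio_code_mx[X hX ->]; rewrite /PSyzLoc; wp.
apply: computes_weaken (computes_clear hX) _ => a ha; wp.
apply: computes_weaken (hsyz _ _ _ _ ha) _ => y [q [Y [hY synY]]].
apply: computes_weaken (computes_loc_mx hY) _ => z hz.
exists q, (map_mx loc Y); split=> // x.
have [D [D' [hD eD]]] := clear_colsE X.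
rewrite -(loc_syzygies synY) eD; split=> [h|]; first by rewrite mulmxA h mul0mx.
by move=> /(congr1 (mulmx^~ D')); rewrite /= -!mulmxA hD mulmx1 mul0mx.
Qed.

End Programs.
End Localization.

(** * Solving linear systems over the local ring *)

Definition PRow := PMx (PConst (nat_tree 1)) (PCols (PVar 0))
  (PEntry (PVar 2) (PVar 3) (PVar 0)).

Lemma computes_row (T : Type) (rep : tree -> T -> Prop) r c (A : 'M[T]_(r, c)) t (i : 'I_r) :
  mx_code rep t A ->
  computes PRow (list_tree [:: t; nat_tree i]) (fun d => mx_code rep d (row i A)).
Proof. by move=> hA; rewrite /PRow; wp => i0 j; wp => d; rewrite mxE. Qed.

Definition PUsubMx := PMx (PVar 1) (PCols (PVar 0)) (PEntry (PVar 2) (PVar 1) (PVar 0)).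

Lemma computes_usubmx (T : Type) (rep : tree -> T -> Prop) r1 r2 c (A : 'M[T]_(r1 + r2, c)) t :
  mx_code rep t A ->
  computes PUsubMx (list_tree [:: t; nat_tree r1]) (fun d => mx_code rep d (usubmx A)).
Proof.
move=> hA; rewrite /PUsubMx; wp => i j; rewrite mxE.
by apply: (computes_entry _ hA (i := lshift r2 i)) => //; wp.
Qed.

Section LocalSolve.
Variables (R : comNzRingType) (rep : tree -> R -> Prop) (ar : ring_progs).
Hypothesis arP : ring_progs_spec rep ar.
Variables (k : nat) (ms : 'I_k -> R) (hm : maximal_ideal (ideal_gen ms)).
Variables (dze : prog) (t_ms : tree).
Hypothesis dzeP : forall r2 r1 r0 (A : 'M[R]_(r1, r0)) (B : 'M[R]_(r2, r0)) t u,
  mx_code rep t A -> mx_code rep u B ->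
  computes dze (list_tree [:: t; u]) (fun d => exists N T dN dT,
    [/\ d = list_tree [:: dN; dT], mx_code rep dN N, mx_code rep dT T &
        is_left_decide_zero A B N T]).
Local Notation gens_mx := (\col_(l < k) ms l).
Hypothesis t_msP : mx_code rep t_ms gens_mx.
Local Notation hS := (maximal_compl_closed hm).
Local Notation loc := (@loc R [predC ideal_gen ms] hS).
Local Notation lrep := (local_code rep hm).

Lemma gens_mxE (c : 'rV[R]_k) : (c *m gens_mx) 0 0 = \sum_l c 0 l * ms l.
Proof. by rewrite mxE; apply: eq_bigr => l _; rewrite mxE. Qed.

(** As m is maximal, the ideal R s + m is the whole ring. *)
Lemma maximal_bezout s : s \notin ideal_gen ms ->
  exists a (c : 'rV[R]_k), 1 = a * s + (c *m gens_mx) 0 0.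
Proof.
move=> sm; have [[m0 m1 mC] maxm] := hm.
pose J : {pred R} := [pred x | `[< exists a, x - a * s \in ideal_gen ms >]].
have mJ : {subset ideal_gen ms <= J}.
  by move=> x xm; apply/asboolP; exists 0; rewrite mul0r subr0.
have sJ : s \in J by apply/asboolP; exists 1; rewrite mul1r subrr.
have [/asboolP[a /asboolP[c hc]]|n1J] := boolP (1 \in J).
  exists a, (\row_l c l); rewrite gens_mxE -[LHS](subrK (a * s)) addrC hc.
  by congr (_ + _); apply: eq_bigr => l _; rewrite mxE.
suff idJ : idealr_closed J by move: sm; rewrite (maxm J idJ mJ).
split=> // [|a x y /asboolP[b xb] /asboolP[d yd]]; first exact: mJ.
apply/asboolP; exists (a * b + d).
have -> : a * x + y - (a * b + d) * s = a * (x - b * s) + (y - d * s) by ring.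
exact: mC.
Qed.

Lemma one_plus_maximal_notin (c : 'rV[R]_k) : 1 + (c *m gens_mx) 0 0 \in [predC ideal_gen ms].
Proof.
have [[_ m1 mC] _] := hm; apply/negP => h.
have : - 1 * (c *m gens_mx) 0 0 + (1 + (c *m gens_mx) 0 0) \in ideal_gen ms.
  by apply: mC => //; apply/asboolP; exists (c 0); apply: gens_mxE.
by rewrite mulN1r addrC addrK => h1; rewrite h1 in m1.
Qed.

(** Solves b = y A over the local ring, for A and b over R, with a single linear
    system over R: b is written in terms of the rows m_l b and the rows of A.
    The result is the list of the entries of y. *)
Definition PLocalSolveRow :=
  PLet (PSeq (PCall dze [:: PCall PColMx [:: PCall (PMulMx ar) [:: PConst t_ms; PVar 1]; PVar 0];
                            PVar 1]) (PVar 1))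
 (PLet (PCall (PMulMx ar) [:: PCall PLsubMx [:: PVar 0; PConst (nat_tree k)]; PConst t_ms])
 (PLet (PCall (add_p ar)
         [:: PConst (one_t ar); PEntry (PVar 0) (PConst (nat_tree 0)) (PConst (nat_tree 0))])
  (* environment: denominator, product of t with the m_l, T, A, b *)
   (PTab (PRows (PVar 3))
     (PList [:: PSeq (PEntry (PVar 3) (PConst (nat_tree 0))
                        (PAddn (PConst (nat_tree k)) (PVar 0))) (opp_p ar);
                PVar 1])))).

(** If s b = z A with s outside m and 1 = a s + mu, mu in m, then b = mu b + a z A, so
    the system over R is solvable.  Its solution T = (t, T') satisfies
    (1 + sum t_l m_l) b = - T' A, and 1 + sum t_l m_l is not in m. *)
Lemma computes_local_solve_row n c (A : 'M[R]_(n, c)) (b : 'rV[R]_c) t u :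
  mx_code rep t A -> mx_code rep u b ->
  (exists x, x *m map_mx loc A = map_mx loc b) ->
  computes PLocalSolveRow (list_tree [:: t; u]) (fun d =>
    exists2 y, y *m map_mx loc A = map_mx loc b &
    exists f, d = list_tree [seq f j | j <- enum 'I_n] /\ forall j, lrep (f j) (y 0 j)).
Proof.
move=> hA hb [x /loc_solvable[s sS [z hz]]].
rewrite /PLocalSolveRow; wp.
apply: computes_weaken (computes_mul_mx arP t_msP hb) _ => w hw; wp.
apply: computes_weaken (computes_col_mx hw hA) _ => v hv; wp.
apply: computes_weaken (dzeP hv hb) _ => _ [N [T [dN [dT [-> hN hT [eN hN0]]]]]]; wp.
apply: computes_weaken (computes_lsubmx hT) _ => w1 hw1; wp.
apply: computes_weaken (computes_mul_mx arP hw1 t_msP) _ => w2 hw2; wp.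
apply: (computes_entry _ hw2 (i := 0) (j := 0)) => [|||e he]; [by wp..|].
wp; apply: computes_weaken (add_pP arP (one_tP arP) he) _ => e1 he1.
set den := 1 + _ in he1; have denS : den \in [predC ideal_gen ms] := one_plus_maximal_notin _.
apply: (computes_tab (n := n) (Q := fun j d => lrep d (frac hS (- T 0 (rshift k j)) denS))).
- by wp.
- move=> j; wp; apply: (computes_entry _ hT (i := 0) (j := rshift k j)) => [|||a ha]; [by wp..|].
  wp; apply: computes_weaken (opp_pP arP ha) _ => a' ha'; wp.
  exact: loc_codeI ha' he1.
move=> f hf; exists (\row_j frac hS (- T 0 (rshift k j)) denS); last first.
  by exists f; split=> // j; rewrite mxE.
have [a [g hg]] := maximal_bezout sS.
(* b = mu b + a z A solves the system, so its remainder N vanishes *)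
have {hN0} N0 : N = 0.
  apply/row_matrixP => i; rewrite row0; apply: hN0; exists (row_mx g (a *: z)).
  rewrite [i]ord1 row_id mul_row_col mulmxA [g *m _]mx11_scalar mul_scalar_mx.
  by rewrite -scalemxAl -hz scalerA -scalerDl addrC -hg scale1r.
move: eN; rewrite N0 -{1}[T]hsubmxK mul_row_col mulmxA [lsubmx T *m _]mx11_scalar.
rewrite mul_scalar_mx => /esym/eqP; rewrite addrAC addr_eq0 -{2}[b]scale1r -scalerDl.
rewrite [_ + 1]addrC => /eqP eb.
have eY : loc den *: (\row_j frac hS (- T 0 (rshift k j)) denS) = map_mx loc (- rsubmx T).
  by apply/rowP => j; rewrite !mxE mulrC frac_mul_loc.
apply/rowP => j; apply: (mul_loc_inj (hS := hS) denS).
have /rowP/(_ j) : loc den *: ((\row_j frac hS (- T 0 (rshift k j)) denS) *m map_mx loc A) =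
   loc den *: map_mx loc b.
  by rewrite scalemxAl eY -map_mxM -map_mxZ eb mulNmx.
by rewrite !mxE => h; rewrite mulrC [RHS]mulrC.
Qed.

(** Denominators are cleared in A and B simultaneously, so that both undergo the
    same scaling of columns; the rows of B are then treated one at a time, each
    with a denominator of its own. *)
Definition PLocalSolve :=
  PLet (PCall (PClear ar) [:: PCall PColMx [:: PVar 0; PVar 1]])
 (PLet (PCall PUsubMx [:: PVar 0; PRows (PVar 1)])
  (* environment: A cleared, A and B stacked and cleared, A, B *)
   (PList [:: PRows (PVar 3); PRows (PVar 2);
              PTab (PRows (PVar 3))
                (PCall PLocalSolveRow
                   [:: PVar 1; PCall PRow [:: PVar 2; PAddn (PRows (PVar 3)) (PVar 0)]])])).

Lemma local_effective_solutions : effective_solutions lrep PLocalSolve.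
Proof.
move=> r2 r1 c A B t u hA hB [X0 hX0].
rewrite /PLocalSolve; wp.
apply: computes_weaken (computes_col_mx hA hB) _ => v hv; wp.
have [X hX eX] := ratio_code_mx hv; have [D [D' [hD eD]]] := clear_colsE hS X.
apply: computes_weaken (computes_clear arP hX) _ => w.
set C := clear_cols X in eD * => hC; wp.
apply: computes_weaken (computes_usubmx hC) _ => w' hw'.
have eA : map_mx loc (usubmx C) = A *m D by rewrite map_usubmx eD -eX mul_col_mx col_mxKu.
have eB : map_mx loc (dsubmx C) = B *m D by rewrite map_dsubmx eD -eX mul_col_mx col_mxKd.
have eBi i : map_mx loc (row (rshift r1 i) C) = row i B *m D.
  by rewrite -row_mul -eB; apply/rowP => j; rewrite !mxE.
have /choice[y hy] : forall i, exists y, y *m map_mx loc (usubmx C) = row i B *m D /\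
  computes (PCall PLocalSolveRow
              [:: PVar 1; PCall PRow [:: PVar 2; PAddn (PRows (PVar 3)) (PVar 0)]])
    (list_tree [:: nat_tree i; w'; w; t; u]) (fun d =>
    exists f, d = list_tree [seq f j | j <- enum 'I_r1] /\ forall j, lrep (f j) (y 0 j)).
  move=> i; have hb : exists x, x *m map_mx loc (usubmx C) = map_mx loc (row (rshift r1 i) C).
    by exists (row i X0); rewrite eBi eA mulmxA -row_mul hX0.
  suff [d rd [y hy hf]] : computes
      (PCall PLocalSolveRow [:: PVar 1; PCall PRow [:: PVar 2; PAddn (PRows (PVar 3)) (PVar 0)]])
      (list_tree [:: nat_tree i; w'; w; t; u]) (fun d =>
      exists2 y, y *m map_mx loc (usubmx C) = map_mx loc (row (rshift r1 i) C) &
      exists f, d = list_tree [seq f j | j <- enum 'I_r1] /\ forall j, lrep (f j) (y 0 j)).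
    exists y; split; last by exists d.
    by rewrite hy eBi.
  wp; apply: computes_weaken (computes_row (rshift r1 i) hC) _ => b hb'; wp.
  exact: computes_local_solve_row.
apply: (@computes_mx_rows _ lrep r2 r1 (\matrix_i y i)).
- by wp.
- by wp.
- move=> i; apply: computes_weaken (hy i).2 _ => d [f [-> hf]]; exists f.
  by split=> // j; rewrite mxE.
move=> d hd; exists (\matrix_i y i) => //.
have : (\matrix_i y i) *m A *m D = B *m D.
  apply/row_matrixP => i; rewrite -mulmxA -eA row_mul rowK (hy i).1.
  by rewrite row_mul.
by move=> /(congr1 (mulmx^~ D')); rewrite /= -!mulmxA hD !mulmx1.
Qed.
End LocalSolve.

(** * Programs for finite presentations *)

Section EffectiveFPres.
Variables (Q : comPzRingType) (rep : tree -> Q -> Prop) (ar : ring_progs) (syz sol : prog).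
Hypotheses (repP : is_coding rep) (arP : ring_progs_spec rep ar).
Hypotheses (syzP : effective_syzygies rep syz) (solP : effective_solutions rep sol).
Local Notation rho := (fpres_coding rep).

Lemma effective_coherent : coherent Q.
Proof.
move=> r c A; have [t ht] := mx_code_exists repP.2 A.
by have [d _ [q [X [_ hX]]]] := syzP ht; exists q, X.
Qed.

Lemma fpres_valid_coding : valid_coding rho.
Proof.
split; first split.
- move=> t M N [r [c [A [hA ->]]]] [r' [c' [B [hB ->]]]].
  have [er [ec eAB]] := mx_code_inj repP.1 hA hB.
  by subst r' c'; rewrite -eAB castmx_id.
- move=> M; have [r [c [A ->]]] := fpobj_of_surj M.
  by have [t ht] := mx_code_exists repP.2 A; exists t, r, c, A.
- move=> M N; split=> [t f g [phi hphi ->] [psi hpsi ->]|f].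
    have [er [ec e]] := mx_code_inj repP.1 hphi hpsi.
    congr fphom_of; apply: val_inj; rewrite /= -e.
    by rewrite (eq_irrelevance er erefl) (eq_irrelevance ec erefl) castmx_id.
  have [phi ->] := fphom_of_surj f.
  by have [t ht] := mx_code_exists repP.2 (fpmor_mx phi); exists t, phi.
Qed.

Lemma fpres_effective_id : effective_id rho.
Proof.
exists (PCall (PIdMx ar) [:: PCols PId]) => M tM [r [c [A [hA ->]]]]; wp.
apply: computes_weaken (computes_id_mx arP c) _ => d hd.
by exists (fpmor_id (fpobj_of A)).
Qed.

Lemma fpres_effective_comp : effective_comp rho.
Proof.
exists (PCall (PMulMx ar) [:: PVar 3; PVar 4]).
move=> M N L f g tM tN tL tf tg _ _ _ [phi hphi ->] [psi hpsi ->]; wp.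
apply: computes_weaken (computes_mul_mx arP hphi hpsi) _ => d hd.
by exists (fpmor_comp phi psi) => //; apply: comp_fphom_of.
Qed.

Lemma fpres_effective_zero_obj : effective_zero_obj rho.
Proof.
exists (PCall (PZeroMx ar) [:: PConst (nat_tree 0); PConst (nat_tree 0)]); wp.
apply: computes_weaken (computes_zero_mx arP 0 0) _ => d hd.
exists (free_obj Q 0); last exact: zero_obj_free.
by exists 0%N, 0%N, 0.
Qed.

Lemma fpres_effective_zero_hom : effective_zero_hom rho.
Proof.
exists (PCall (PZeroMx ar) [:: PCols (PVar 0); PCols (PVar 1)]).
move=> M N tM tN [r [c [A [hA ->]]]] [r' [c' [B [hB ->]]]]; wp.
apply: computes_weaken (computes_zero_mx arP c c') _ => d hd.
by exists 0 => //; rewrite fphom_of0.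
Qed.

Lemma fpres_effective_add : effective_add rho.
Proof.
exists (PCall (PAddMx ar) [:: PVar 2; PVar 3]).
move=> M N f g tM tN tf tg _ _ [phi hphi ->] [psi hpsi ->]; wp.
apply: computes_weaken (computes_add_mx arP hphi hpsi) _ => d hd.
by exists (phi + psi) => //; rewrite fphom_ofD.
Qed.

Lemma fpres_effective_sub : effective_sub rho.
Proof.
exists (PCall (PAddMx ar) [:: PVar 2; PSeq (PVar 3) (POppMx ar)]).
move=> M N f g tM tN tf tg _ _ [phi hphi ->] [psi hpsi ->]; wp.
apply: computes_weaken (computes_opp_mx arP hpsi) _ => o ho; wp.
apply: computes_weaken (computes_add_mx arP hphi ho) _ => d hd.
exists (phi - psi) => //; apply: (addIr (fphom_of psi)).
by rewrite -fphom_ofD !subrK.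
Qed.

Definition PDirectSum := PList [::
  PCall PColMx [:: PCall PRowMx [:: PVar 0; PCall (PZeroMx ar) [:: PRows (PVar 0); PCols (PVar 1)]];
                   PCall PRowMx [:: PCall (PZeroMx ar) [:: PRows (PVar 1); PCols (PVar 0)]; PVar 1]];
  PCall PRowMx [:: PCall (PIdMx ar) [:: PCols (PVar 0)];
                   PCall (PZeroMx ar) [:: PCols (PVar 0); PCols (PVar 1)]];
  PCall PRowMx [:: PCall (PZeroMx ar) [:: PCols (PVar 1); PCols (PVar 0)];
                   PCall (PIdMx ar) [:: PCols (PVar 1)]];
  PCall PColMx [:: PCall (PIdMx ar) [:: PCols (PVar 0)];
                   PCall (PZeroMx ar) [:: PCols (PVar 1); PCols (PVar 0)]];
  PCall PColMx [:: PCall (PZeroMx ar) [:: PCols (PVar 0); PCols (PVar 1)];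
                   PCall (PIdMx ar) [:: PCols (PVar 1)]]].

Lemma fpres_effective_direct_sum : effective_direct_sum rho.
Proof.
exists PDirectSum, (PCall PColMx [:: PVar 3; PVar 4]), (PCall PRowMx [:: PVar 3; PVar 4]).
move=> M N tM tN [a [m [A [hA eM]]]] [b [n [B [hB eN]]]]; subst M N; rewrite /PDirectSum.
wp; apply: computes_weaken (computes_zero_mx arP a n) _ => z1 hz1.
wp; apply: computes_weaken (computes_row_mx hA hz1) _ => u hu.
wp; apply: computes_weaken (computes_zero_mx arP b m) _ => z2 hz2.
wp; apply: computes_weaken (computes_row_mx hz2 hB) _ => v hv.
wp; apply: computes_weaken (computes_col_mx hu hv) _ => s hs.
wp; apply: computes_weaken (computes_id_mx arP m) _ => o1 ho1.
wp; apply: computes_weaken (computes_zero_mx arP m n) _ => o2 ho2.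
wp; apply: computes_weaken (computes_row_mx ho1 ho2) _ => i1 hi1.
wp; apply: computes_weaken (computes_zero_mx arP n m) _ => o3 ho3.
wp; apply: computes_weaken (computes_id_mx arP n) _ => o4 ho4.
wp; apply: computes_weaken (computes_row_mx ho3 ho4) _ => i2 hi2.
wp; apply: computes_weaken (computes_id_mx arP m) _ => o5 ho5.
wp; apply: computes_weaken (computes_zero_mx arP n m) _ => o6 ho6.
wp; apply: computes_weaken (computes_col_mx ho5 ho6) _ => p1 hp1.
wp; apply: computes_weaken (computes_zero_mx arP m n) _ => o7 ho7.
wp; apply: computes_weaken (computes_id_mx arP n) _ => o8 ho8.
wp; apply: computes_weaken (computes_col_mx ho7 ho8) _ => p2 hp2.
wp; exists (sum_obj A B), (fphom_of (sum_inl A B)), (fphom_of (sum_inr A B)),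
  (fphom_of (sum_prl A B)), (fphom_of (sum_prr A B)), s, i1, i2, p1, p2.
split.
- by [].
- split; [by exists (a + b)%N, (m + n)%N, (block_mx A 0 0 B) | ..].
  + by exists (sum_inl A B).
  + by exists (sum_inr A B).
  + by exists (sum_prl A B).
  + by exists (sum_prr A B).
- exact: is_direct_sum_sum.
- move=> L f g tL tf tg _ [phi hphi ->] [psi hpsi ->]; wp.
  apply: computes_weaken (computes_col_mx hphi hpsi) _ => d hd.
  exists (fphom_of (sum_copair phi psi)); split; first by exists (sum_copair phi psi).
    exact: sum_inl_copair.
  exact: sum_inr_copair.
- move=> L f g tL tf tg _ [phi hphi ->] [psi hpsi ->]; wp.
  apply: computes_weaken (computes_row_mx hphi hpsi) _ => d hd.
  exists (fphom_of (sum_pairing phi psi)); split; first by exists (sum_pairing phi psi).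
    exact: sum_pairing_prl.
  exact: sum_pairing_prr.
Qed.

Definition PKer :=
  PLet (PCall PLsubMx [:: PSeq (PCall PColMx [:: PVar 2; PVar 1]) syz; PCols (PVar 0)])
    (PList [:: PCall PLsubMx [:: PSeq (PCall PColMx [:: PVar 0; PVar 1]) syz; PRows (PVar 0)];
               PVar 0]).

(** The kernel lift runs the kernel program again to recover the embedding, and so
    refers to the same kernel. *)
Lemma fpres_effective_kernel : effective_kernel rho.
Proof.
exists PKer, (PCall sol [:: PSeq (PCall PKer [:: PVar 0; PVar 1; PVar 2]) (PVar 1); PVar 4]).
move=> M N f tM tN tf [r [c [A [hA eM]]]] [d [p [B [hB eN]]]]; subst M N.
move=> [phi hphi ->].
suff h : computes PKer (list_tree [:: tM; tN; tf]) (fun y =>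
   exists q l (X : 'M_(q, c + d)) (Y : 'M_(l, q + r)) u v,
   [/\ y = list_tree [:: v; u], mx_code rep u (lsubmx X), mx_code rep v (lsubmx Y),
       is_left_syzygies (col_mx (fpmor_mx phi) B) X &
       is_left_syzygies (col_mx (lsubmx X) A) Y]).
  apply: computes_weaken (computes_run h) _ => y [ry].
  move=> [q [l [X [Y [u [v [ey hu hv hX hY]]]]]]].
  exists (ker_obj Y), (fphom_of (ker_mor hY)), v, u; split=> //.
  - split; first by exists l, q, (lsubmx Y).
    by exists (ker_mor hY).
  - exact: is_kernel_ker hX hY.
  - move=> L g tL tg _ [tau htau ->] /comp_eq0P tau0.
    have [Z hZ] : exists Z, fpmor_mx tau = Z *m lsubmx X.
      apply: mulmx_factor => x; apply/(lsubmx_syzygies _ hX); exact: tau0.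
    wp; exists y => //; rewrite ey; wp.
    apply: computes_weaken (solP hu htau _) _; first by exists Z.
    move=> w [W hW eW].
    have hWL z : rels L z -> rels (ker_obj Y) (z *m W).
      by move=> hz; apply/(rels_ker hY); rewrite -mulmxA eW; apply: fpmorP.
    exists (fphom_of (@fpmor_of _ L (ker_obj Y) W hWL)); split.
      by exists (@fpmor_of _ L (ker_obj Y) W hWL).
    apply/comp_eqP => x; rewrite -mulmxA /= eW subrr; exact: (rels0 (fpobj_of A)).
rewrite /PKer; wp; apply: computes_weaken (computes_col_mx hphi hB) _ => t1 ht1.
wp; apply: computes_weaken (syzP ht1) _ => t2 [q [X [ht2 hX]]].
wp; apply: computes_weaken (computes_lsubmx ht2) _ => u hu.
wp; apply: computes_weaken (computes_col_mx hu hA) _ => t3 ht3.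
wp; apply: computes_weaken (syzP ht3) _ => t4 [l [Y [ht4 hY]]].
wp; apply: computes_weaken (computes_lsubmx ht4) _ => v hv.
by wp; exists q, l, X, Y, u, v.
Qed.

Lemma fpres_effective_cokernel : effective_cokernel rho.
Proof.
exists (PList [:: PCall PColMx [:: PVar 2; PVar 1]; PCall (PIdMx ar) [:: PCols (PVar 1)]]).
exists (PVar 4).
move=> M N f tM tN tf _ [d [p [B [hB eN]]]]; subst N => -[phi hphi ->].
wp; apply: computes_weaken (computes_col_mx hphi hB) _ => u hu.
wp; apply: computes_weaken (computes_id_mx arP p) _ => v hv.
wp; exists (quot_obj B (fpmor_mx phi)), (fphom_of (quot_mor B (fpmor_mx phi))), u, v.
split=> //.
- split; last by exists (quot_mor B (fpmor_mx phi)).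
  by exists (gens M + d)%N, p, (col_mx (fpmor_mx phi) B).
- exact: is_cokernel_quot.
- move=> L g tL tg _ [eta heta ->] /comp_eq0P eta0; wp.
  have hL z : rels (quot_obj B (fpmor_mx phi)) z -> rels L (z *m fpmor_mx eta).
    move=> /rels_quot[x hx]; apply: rels_congr (eta0 x).
    by rewrite -mulmxBl; apply: (fpmorP eta).
  exists (fphom_of (@fpmor_of _ (quot_obj B (fpmor_mx phi)) L _ hL)); split.
    by exists (@fpmor_of _ (quot_obj B (fpmor_mx phi)) L _ hL).
  by apply/comp_eqP => x; rewrite mulmx1 /= subrr; apply: rels0.
Qed.

(** The first variable bound is a lift F of phi along eps on generators, the second
    a matrix Y with P Y P = P; the result is (1 - Y P) F. *)
Definition PProjLift :=
  PLet (PCall PLsubMx [:: PCall sol [:: PCall PColMx [:: PVar 4; PVar 2]; PVar 3]; PCols (PVar 1)])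
 (PLet (PCall PUnvec [:: PCall sol [:: PCall (PKron ar) [:: PVar 1]; PCall PVec [:: PVar 1]];
                         PCols (PVar 1); PRows (PVar 1)])
   (PCall (PMulMx ar)
      [:: PCall (PAddMx ar) [:: PCall (PIdMx ar) [:: PCols (PVar 2)];
                                PSeq (PCall (PMulMx ar) [:: PVar 0; PVar 2]) (POppMx ar)];
          PVar 1])).

Lemma fpres_effective_projective_lift : effective_projective_lift rho.
Proof.
exists PProjLift => P M N f g tP tM tN tf tg.
move=> [r [c [A [hA eP]]]] [b [n [B [hB eM]]]] [d [p [D [hD eN]]]]; subst P M N.
move=> [phi hphi ->] [eps heps ->] /projective_regular[Y0 hY0] /im_le_rels hle.
rewrite /PProjLift; wp; apply: computes_weaken (computes_col_mx heps hD) _ => t1 ht1.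
wp; apply: computes_weaken (solP ht1 hphi _) _.
  have [|Z hZ] := @mulmx_factor Q c p (n + d) (fpmor_mx phi) (col_mx (fpmor_mx eps) D).
    move=> x; have [y [z hz]] := hle x; exists (row_mx y z).
    by rewrite mul_row_col -hz addrC subrK.
  by exists Z.
move=> t2 [X ht2 eX].
wp; apply: computes_weaken (computes_lsubmx ht2) _ => t3 ht3.
wp; apply: computes_weaken (computes_kron arP hA) _ => t4 ht4.
wp; apply: computes_weaken (computes_vec hA) _ => t5 ht5.
wp; apply: computes_weaken (solP ht4 ht5 _) _.
  by exists (vec Y0); rewrite mul_kron vecK hY0.
move=> t6 [y ht6]; rewrite mul_kron => /(congr1 (@unvec Q r c)); rewrite !vecK => hY.
wp; apply: computes_weaken (computes_unvec ht6) _ => t7 ht7.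
wp; apply: computes_weaken (computes_id_mx arP c) _ => t8 ht8.
wp; apply: computes_weaken (computes_mul_mx arP ht7 hA) _ => t9 ht9.
wp; apply: computes_weaken (computes_opp_mx arP ht9) _ => t10 ht10.
wp; apply: computes_weaken (computes_add_mx arP ht8 ht10) _ => t11 ht11.
wp; apply: computes_weaken (computes_mul_mx arP ht11 ht3) _ => t12 ht12.
exists (fphom_of (@regular_lift Q r c A _ (fpobj_of B) (lsubmx X) hY)); split.
  by exists (@regular_lift Q r c A _ (fpobj_of B) (lsubmx X) hY).
apply: regular_liftP => x; rewrite -eX -{1}[X]hsubmxK mul_row_col mulmxDr.
rewrite mulmxA addrAC subrr add0r; by exists (x *m rsubmx X); rewrite mulmxA.
Qed.

Lemma fpres_effective_projective_hull : effective_projective_hull rho.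
Proof.
exists (PList [:: PCall (PZeroMx ar) [:: PConst (nat_tree 0); PCols PId];
                  PCall (PIdMx ar) [:: PCols PId]]).
move=> M tM [r [c [A [hA ->]]]].
wp; apply: computes_weaken (computes_zero_mx arP 0 c) _ => u hu.
wp; apply: computes_weaken (computes_id_mx arP c) _ => v hv.
wp; exists (free_obj Q c), (fphom_of (free_cover A)), u, v; split=> //.
- split; last by exists (free_cover A).
  by exists 0%N, c, 0.
- by apply: surj_epi => z; apply: free_cover_surj.
- exact: free_projective.
Qed.

Theorem fpres_computable :
  computable_abelian_enough_projectives rho.
Proof.
split; [split | exact: fpres_effective_projective_lift | exact: fpres_effective_projective_hull].
- exact/fpres_abelian/effective_coherent.
- exact: fpres_valid_coding.
- split; [exact: fpres_effective_id | exact: fpres_effective_comp |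
    exact: fpres_effective_zero_obj | exact: fpres_effective_zero_hom].
- by split; [exact: fpres_effective_add | exact: fpres_effective_sub].
- by split; [exact: fpres_effective_direct_sum | exact: fpres_effective_kernel |
    exact: fpres_effective_cokernel].
Qed.

End EffectiveFPres.

(** * The local ring *)

Lemma local_is_coding (R : comNzRingType) (rep : tree -> R -> Prop) (m : {pred R})
    (hm : maximal_ideal m) : is_coding rep -> is_coding (local_code rep hm).
Proof.
move=> [rep_inj rep_ex]; split.
  move=> _ _ _ [x [u [v [hu hv -> ->]]]] [y [u' [v' [hu' hv' [eu ev] ->]]]].
  subst u' v'; congr (\pi_(local_ring hm) _)%qT; apply: val_inj.
  rewrite [LHS]surjective_pairing [RHS]surjective_pairing.
  by congr pair; [apply: rep_inj hu hu' | apply: rep_inj hv hv'].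
move=> q; pose x := repr q; have [u hu] := rep_ex (Localization.numden x).1.
have [v hv] := rep_ex (Localization.numden x).2.
by exists (list_tree [:: u; v]), x, u, v; split=> //; rewrite reprK.
Qed.

Theorem corollary4p2 (R : comNzRingType) (rep : tree -> R -> Prop)
    (hR : computable_ring rep) (k : nat) (ms : 'I_k -> R)
    (hm : maximal_ideal (ideal_gen ms)) :
  abelian (fpres (local_ring hm)) /\
  computable_abelian_enough_projectives (fpres_coding (local_code rep hm)).
Proof.
suff h : computable_abelian_enough_projectives (fpres_coding (local_code rep hm)).
  by split=> //; case: h => [[]].
have [[repP [add hadd] [opp hopp] [mul hmul] _] [[syz hsyz] [dze hdze]] _] := hR.
have [z hz] := repP.2 0; have [o ho] := repP.2 1.
have arP : ring_progs_spec rep (RingProgs z o add opp mul) by split.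
have [t_ms ht_ms] := mx_code_exists repP.2 (\col_(l < k) ms l).
apply: (fpres_computable (local_is_coding hm repP) (loc_ring_progsP (maximal_compl_closed hm) arP)).
- exact: (loc_effective_syzygies (hS := maximal_compl_closed hm) arP hsyz).
- exact: (local_effective_solutions arP hdze ht_ms).
Qed.
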